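(* Suppose the MDP is uniformly ergodic, let $\gamma\in[1/2,1)$ with $t_{\mathrm{minorize}}\le(1-\gamma)^{-1}$, let $\zeta>0$, $\delta\in(0,1)$, and let $n\ge 64\,\beta_\delta(\eta^*_\delta)(1-\gamma)^{-1}$. Then the policy $\hat\pi_0$ returned by PMBP$(\gamma,\zeta,n)$ satisfies, with probability at least $1-\delta$, \[ 0\le v^*-v^{\hat\pi_0}\le \frac{2\zeta}{1-\gamma}+486\sqrt{\frac{\beta_\delta(\eta^*_\delta)\,t_{\mathrm{minorize}}}{(1-\gamma)^2 n}} \] (entrywise). Consequently, choosing $\zeta=(1-\gamma)\epsilon/4$ and $n=\frac{c\,t_{\mathrm{minorize}}\,\beta_\delta(\eta^*_\delta)}{(1-\gamma)^2\epsilon^2}$ with $c=4\cdot486^2$, for any $0<\epsilon\le\sqrt{t_{\mathrm{minorize}}/(1-\gamma)}$ one has $\|v^*-v^{\hat\pi_0}\|_\infty\le\epsilon$ with probability at least $1-\delta$, using a total of $|S||A|n=\widetilde O\big(|S||A|t_{\mathrm{minorize}}(1-\gamma)^{-2}\epsilon^{-2}\big)$ samples.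
   Context: $S,A$ finite; reward $r:S\times A\to[0,1]$; kernel $P=\{p_{s,a}\in\mathcal P(S)\}$; $p[v]=\sum_s p(s)v(s)$. $\Pi$ = deterministic stationary Markov policies $\pi:S\to A$; $P_\pi(s,s')=p_{s,\pi(s)}(s')$, $r_\pi(s)=r(s,\pi(s))$. Discounted value $v^\pi=(I-\gamma P_\pi)^{-1}r_\pi$ and $v^*(s)=\max_{\pi\in\Pi}v^\pi(s)$. Uniform ergodicity: for every $\pi\in\Pi$ there exist an integer $m\ge1$, $q\in(0,1]$, $\psi\in\mathcal P(S)$ with $P_\pi^m(s,\cdot)\ge q\psi(\cdot)$ for all $s$. $t_{\mathrm{minorize}}(P_\pi)=\inf\{m/q:\ P_\pi^m(s,\cdot)\ge q\psi(\cdot)\ \forall s\text{ for some }\psi\}$, $t_{\mathrm{minorize}}=\max_{\pi}t_{\mathrm{minorize}}(P_\pi)$. Algorithm PMBP$(\gamma,\zeta,n)$: draw $Z(s,a)\sim\mathrm{Unif}(0,\zeta)$ i.i.d. over $(s,a)$, set $R=r+Z$; independently, for each $(s,a)$ draw $n$ i.i.d. samples from $p_{s,a}$ via a generative model and form the empirical distribution $\hat p_{s,a}$; compute the unique $\hat v_0$ with $\hat v_0(s)=\max_a\{R(s,a)+\gamma\hat p_{s,a}[\hat v_0]\}$ and return $\hat\pi_0(s)\in\arg\max_a\{R(s,a)+\gamma\hat p_{s,a}[\hat v_0]\}$. $\beta_\delta(\eta)=2\log\!\Big(\frac{24|S||A|\log_2((1-\gamma)^{-1})}{(1-\gamma)^2\eta\delta}\Big)$,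 $\eta^*_\delta=\frac{\zeta\delta(1-\gamma)}{9|S||A|^2}$. *)

(* Defs.v *)
From HB Require Import structures.
From mathcomp Require Import all_boot all_order all_algebra.
From mathcomp Require Import all_classical all_reals all_analysis.
Set Implicit Arguments. Unset Strict Implicit. Unset Printing Implicit Defensive.
Import Order.TTheory GRing.Theory Num.Theory.
Local Open Scope classical_set_scope.
Local Open Scope ring_scope.

Section MDP.
Variables (R : realType) (nS nA : nat).

Definition is_kernel (p : 'I_nS -> 'I_nA -> 'I_nS -> R) : Prop :=
  (forall s a s', 0 <= p s a s') /\ (forall s a, \sum_(s' < nS) p s a s' = 1).

Definition is_prob (psi : 'I_nS -> R) : Prop :=
  (forall s, 0 <= psi s) /\ \sum_(s < nS) psi s = 1.

Definition Ppi (p : 'I_nS -> 'I_nA -> 'I_nS -> R) (pi : {ffun 'I_nS -> 'I_nA})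
  : 'M[R]_nS := \matrix_(s, s') p s (pi s) s'.

Definition rpi (r : 'I_nS -> 'I_nA -> R) (pi : {ffun 'I_nS -> 'I_nA}) : 'cV[R]_nS :=
  \col_s r s (pi s).

Definition vpi (gamma : R) (r : 'I_nS -> 'I_nA -> R)
  (p : 'I_nS -> 'I_nA -> 'I_nS -> R) (pi : {ffun 'I_nS -> 'I_nA}) (s : 'I_nS) : R :=
  (invmx (1%:M - gamma *: Ppi p pi) *m rpi r pi) s ord0.

(* v^*(s) = max_pi v^pi(s)  (sup of a finite nonempty set = its max) *)
Definition vstar (gamma : R) (r : 'I_nS -> 'I_nA -> R)
  (p : 'I_nS -> 'I_nA -> 'I_nS -> R) (s : 'I_nS) : R :=
  sup [set vpi gamma r p pi s | pi in [set: {ffun 'I_nS -> 'I_nA}]].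

Definition minorizes (P : 'M[R]_nS) (m : nat) (q : R) (psi : 'I_nS -> R) : Prop :=
  (1 <= m)%N /\ 0 < q <= 1 /\ is_prob psi /\
  forall s s', q * psi s' <= (P ^+ m) s s'.

Definition uniformly_ergodic (p : 'I_nS -> 'I_nA -> 'I_nS -> R) : Prop :=
  forall pi : {ffun 'I_nS -> 'I_nA},
    exists m q psi, minorizes (Ppi p pi) m q psi.

Definition tminorize_mx (P : 'M[R]_nS) : R :=
  inf [set x : R | exists m q psi, minorizes P m q psi /\ x = m%:R / q].

Definition tminorize (p : 'I_nS -> 'I_nA -> 'I_nS -> R) : R :=
  sup [set tminorize_mx (Ppi p pi) | pi in [set: {ffun 'I_nS -> 'I_nA}]].

Definition log2 (x : R) : R := ln x / ln 2.

Definition beta (gamma delta eta : R) : R :=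
  2 * ln ((24 * (nS * nA)%:R * log2 ((1 - gamma)^-1))
          / ((1 - gamma) ^+ 2 * eta * delta)).

Definition eta_star (gamma zeta delta : R) : R :=
  zeta * delta * (1 - gamma) / (9 * (nS * nA ^ 2)%:R).

Definition emp (n : nat) (X : 'I_n -> 'I_nS) (s' : 'I_nS) : R :=
  #|[set i : 'I_n | X i == s']|%:R / n%:R.

(* v is the (unique) fixed point of the perturbed empirical Bellman operator *)
Definition emp_bellman_fixpoint (gamma : R) (Rw : 'I_nS -> 'I_nA -> R)
  (ph : 'I_nS -> 'I_nA -> 'I_nS -> R) (v : 'I_nS -> R) : Prop :=
  forall s, v s = sup [set Rw s a + gamma * \sum_(s' < nS) ph s a s' * v s'
                      | a in [set: 'I_nA]].

Definition greedy (gamma : R) (Rw : 'I_nS -> 'I_nA -> R)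
  (ph : 'I_nS -> 'I_nA -> 'I_nS -> R) (v : 'I_nS -> R)
  (pi : {ffun 'I_nS -> 'I_nA}) : Prop :=
  forall s a, Rw s a + gamma * \sum_(s' < nS) ph s a s' * v s'
              <= Rw s (pi s) + gamma * \sum_(s' < nS) ph s (pi s) s' * v s'.

End MDP.
Arguments emp {R nS n}.

Section Randomness.
Local Open Scope ereal_scope.
Variables (d : measure_display) (Omega : measurableType d) (R : realType)
  (P : probability Omega R) (nS nA n : nat).

Definition uniform_rv (zeta : R) (Z : Omega -> R) : Prop :=
  measurable_fun setT Z /\
  forall B : set R, measurable B ->
    P (Z @^-1` B) = lebesgue_measure (B `&` `]0%R, zeta[) * (zeta^-1)%:E.

Definition sample_rv (q : 'I_nS -> R) (X : Omega -> 'I_nS) : Prop :=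
  forall s', measurable (X @^-1` [set s']) /\ P (X @^-1` [set s']) = (q s')%:E.

(* mutual independence of the family {Z(s,a)} u {X(s,a,i)} :
   product rule for every choice of (measurable) events, one per variable
   (taking setT recovers all subfamilies). *)
Definition mutually_independent
  (Z : 'I_nS -> 'I_nA -> Omega -> R)
  (X : 'I_nS -> 'I_nA -> 'I_n -> Omega -> 'I_nS) : Prop :=
  forall (B : 'I_nS -> 'I_nA -> set R) (C : 'I_nS -> 'I_nA -> 'I_n -> set 'I_nS),
    (forall s a, measurable (B s a)) ->
    P ((\bigcap_(sa : 'I_nS * 'I_nA) (Z sa.1 sa.2 @^-1` B sa.1 sa.2)) `&`
       (\bigcap_(sai : 'I_nS * 'I_nA * 'I_n)
           (X sai.1.1 sai.1.2 sai.2 @^-1` C sai.1.1 sai.1.2 sai.2)))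
    = (\prod_(sa : 'I_nS * 'I_nA) P (Z sa.1 sa.2 @^-1` B sa.1 sa.2)) *
      (\prod_(sai : 'I_nS * 'I_nA * 'I_n)
           P (X sai.1.1 sai.1.2 sai.2 @^-1` C sai.1.1 sai.1.2 sai.2)).

End Randomness.

(* Main.v *)
(* Only the boundedness of the perturbation is used, not the gap it creates between actions.
   Write v for the empirical optimal value, x = sqrt (beta t / n), H = 1 / (1 - gamma).

   Freezing the value of v at a state s to a point of a finite grid, and discretizing the
   perturbation, gives functions w that are independent of the samples drawn at s and close to v.
   Bernstein's inequality with the exponent fixed in advance to x / M, where M = max (t, osc w),
   bounds (P^ - P) w by x M / t + (x / M) Var_P w up to constants, and hence (P^ - P) v likewise.

   The variance of v telescopes: with u = v - min v and G = u^2 - 2 M u, one gets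
   |(P^ - P) v| <= a + kappa (gamma P G - G) at every state-action pair, where
   a = O(x M / t + x + zeta) and kappa = O(x / M). Comparison principles for v -/+ kappa G bound
   v* - v from above and compare v with the true value of the greedy policy, for a total loss of
   2 kappa M^2 + (zeta + 2 a) H. Finally minorization of the greedy policy's true chain over about
   1 / q blocks gives M = O(t), provided x <= 1 / 486; otherwise the claimed bound exceeds H and is
   trivial. *)
Require Import Defs.
From HB Require Import structures.
From mathcomp Require Import all_boot all_order all_algebra.
From mathcomp Require Import all_classical all_reals all_analysis.
From mathcomp Require Import ring lra.
Import Order.TTheory GRing.Theory Num.Theory.
Local Open Scope classical_set_scope.
Local Open Scope ring_scope.
Set Implicit Arguments.
Unset Strict Implicit.

(** * Averages and comparison principles *)

Section Mean.
Variables (R : realType) (nS : nat).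
Implicit Types (q f g : 'I_nS -> R).

Definition mean q f : R := \sum_(s < nS) q s * f s.

Definition variance q f : R := mean q (fun s => f s ^+ 2) - mean q f ^+ 2.

Lemma mean_le q f g : (forall s, 0 <= q s) -> (forall s, f s <= g s) ->
  mean q f <= mean q g.
Proof. by move=> q0 fg; apply: ler_sum => s _; apply: ler_wpM2l. Qed.

Lemma meanD q f g : mean q (fun s => f s + g s) = mean q f + mean q g.
Proof. by rewrite /mean -big_split; apply: eq_bigr => s _; rewrite mulrDr. Qed.

Lemma meanZ q (c : R) f : mean q (fun s => c * f s) = c * mean q f.
Proof. by rewrite /mean mulr_sumr; apply: eq_bigr => s _; rewrite mulrCA. Qed.

Lemma mean_cst q (c : R) : is_prob q -> mean q (fun=> c) = c.
Proof. by case=> _ q1; rewrite /mean -mulr_suml q1 mul1r. Qed.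

Lemma mean_leC q f (c : R) : is_prob q -> (forall s, f s <= c) -> mean q f <= c.
Proof. by move=> qP fc; rewrite -[leRHS](mean_cst c qP); apply: mean_le => //; case: qP. Qed.

Lemma mean_geC q f (c : R) : is_prob q -> (forall s, c <= f s) -> c <= mean q f.
Proof. by move=> qP fc; rewrite -[leLHS](mean_cst c qP); apply: mean_le => //; case: qP. Qed.

Lemma meanDc q f (c : R) : is_prob q -> mean q (fun s => f s + c) = mean q f + c.
Proof. by move=> qP; rewrite meanD mean_cst. Qed.

Lemma variance_ge0 q f : is_prob q -> 0 <= variance q f.
Proof.
move=> qP.
have : 0 <= mean q (fun s => (f s - mean q f) ^+ 2).
  by apply: mean_geC => // s; exact: sqr_ge0.
have -> : (fun s => (f s - mean q f) ^+ 2) =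
   (fun s => (f s ^+ 2 + (- 2 * mean q f) * f s) + mean q f ^+ 2).
  by apply/funext => s; ring.
rewrite meanDc// meanD meanZ /variance; lra.
Qed.

Lemma variance_shift q f (c : R) : is_prob q ->
  variance q (fun s => f s + c) = variance q f.
Proof.
move=> qP; rewrite /variance meanDc//.
have -> : (fun s => (f s + c) ^+ 2) = (fun s => (f s ^+ 2 + (2 * c) * f s) + c ^+ 2).
  by apply/funext => s; ring.
rewrite meanDc// meanD meanZ; ring.
Qed.

Lemma variance_le_dev q f (c : R) : is_prob q ->
  variance q f <= mean q (fun s => (f s - c) ^+ 2).
Proof.
move=> qP; rewrite -(variance_shift f (- c) qP) /variance.
have := sqr_ge0 (mean q (fun s => f s - c)); lra.
Qed.

Lemma mean_dist q f g (c : R) : is_prob q -> (forall s, `|f s - g s| <= c) ->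
  `|mean q f - mean q g| <= c.
Proof.
move=> qP fg; rewrite ler_norml; apply/andP; split.
  suff : mean q g <= mean q f + c by lra.
  rewrite -meanDc//; apply: mean_le; first by case: qP.
  by move=> s; have := fg s; rewrite ler_norml => /andP[]; lra.
suff : mean q f <= mean q g + c by lra.
rewrite -meanDc//; apply: mean_le; first by case: qP.
by move=> s; have := fg s; rewrite ler_norml => /andP[]; lra.
Qed.

(** The variance of [f] is at most its mean square deviation from the mean of [g], and a square of a
    sum is at most twice the sum of the squares. *)
Lemma variance_perturb q f g (c : R) : is_prob q ->
  (forall s, `|f s - g s| <= c) ->
  variance q f <= 2 * variance q g + 2 * c ^+ 2.
Proof.
move=> qP fg; set a := mean q g.
apply: (le_trans (variance_le_dev f a qP)).
have -> : 2 * variance q g + 2 * c ^+ 2 =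
    mean q (fun s => 2 * (g s - a) ^+ 2 + 2 * c ^+ 2).
  rewrite meanDc// meanZ; congr (2 * _ + _).
  have -> : (fun s => (g s - a) ^+ 2) =
     (fun s => (g s ^+ 2 + (- 2 * a) * g s) + a ^+ 2).
    by apply/funext => s; ring.
  rewrite meanDc// meanD meanZ /variance -/a; ring.
apply: mean_le; first by case: qP.
move=> s; have : (f s - g s) ^+ 2 <= c ^+ 2.
  by rewrite -real_normK ?num_real// lerXn2r ?nnegrE ?(le_trans _ (fg s)).
by have := sqr_ge0 ((f s - g s) - (g s - a)); nra.
Qed.

End Mean.

Section Comparison.
Variables (R : realType) (nS : nat).
Implicit Types (f : 'I_nS -> R) (K : 'I_nS -> 'I_nS -> R).

(** Maximum principle: at a maximizer of [f] the average of [f] is at most [f] itself. *)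
Lemma subsolution_le K f (gamma b : R) : (forall s, is_prob (K s)) ->
  0 <= gamma < 1 -> (forall s, f s <= gamma * mean (K s) f + b) ->
  forall s, f s <= b / (1 - gamma).
Proof.
move=> KP /andP[g0 g1] fP s.
pose s1 := [arg max_(i > s) f i]%O.
have s1P i : f i <= f s1 by rewrite /s1; case: arg_maxP => // j _; apply.
apply: (le_trans (s1P s)); rewrite ler_pdivlMr; last lra.
have := fP s1; have := mean_leC (KP s1) s1P => h.
by have := ler_wpM2l g0 h; lra.
Qed.

Lemma supersolution_ge K f (gamma b : R) : (forall s, is_prob (K s)) ->
  0 <= gamma < 1 -> (forall s, gamma * mean (K s) f + b <= f s) ->
  forall s, b / (1 - gamma) <= f s.
Proof.
move=> KP g01 fP s.
have : - f s <= - b / (1 - gamma).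
  apply: (subsolution_le (f := fun s => - f s) KP g01) => i.
  have -> : mean (K i) (fun s => - f s) = - mean (K i) f.
    by rewrite /mean -sumrN; apply: eq_bigr => j _; rewrite mulrN.
  by have := fP i; lra.
by rewrite mulNr; lra.
Qed.

End Comparison.

(** * Policy values as solutions of linear Bellman equations *)

Section PolicyValue.
Variables (R : realType) (nS nA : nat).
Implicit Types (r : 'I_nS -> 'I_nA -> R) (p : 'I_nS -> 'I_nA -> 'I_nS -> R).
Implicit Types (pi : {ffun 'I_nS -> 'I_nA}).

Lemma kernel_prob p s a : is_kernel p -> is_prob (p s a).
Proof. by case=> p0 p1; split. Qed.

(** Each column of the cokernel matrix is annihilated by [A], so injectivity makes the cokernel
    zero. *)
Lemma unitmx_col_inj (A : 'M[R]_nS) :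
  (forall u : 'cV[R]_nS, A *m u = 0 -> u = 0) -> A \in unitmx.
Proof.
move=> Ainj; rewrite -row_full_unit -cokermx_eq0; apply/eqP/matrixP => i j.
have /matrixP/(_ i ord0) : col j (cokermx A) = 0.
  by apply: Ainj; rewrite colE mulmxA mulmx_coker mul0mx.
by rewrite !mxE.
Qed.

Lemma mulmx_mean (P : 'M[R]_nS) (f : 'I_nS -> R) s :
  (P *m \col_i f i) s ord0 = mean (P s) f.
Proof. by rewrite !mxE; apply: eq_bigr => i _; rewrite mxE. Qed.

Lemma Ppi_mean p pi s (f : 'I_nS -> R) : mean (Ppi p pi s) f = mean (p s (pi s)) f.
Proof. by apply: eq_bigr => i _; rewrite mxE. Qed.

Lemma Ppi_prob p pi s : is_kernel p -> is_prob (Ppi p pi s).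
Proof.
case=> p0 p1; split=> [i|]; first by rewrite mxE.
by rewrite -[RHS](p1 s (pi s)); apply: eq_bigr => i _; rewrite mxE.
Qed.

(** A vector in the kernel is both a subsolution and a supersolution with [b = 0], hence zero. *)
Lemma resolvent_unit (gamma : R) p pi : is_kernel p -> 0 <= gamma < 1 ->
  1%:M - gamma *: Ppi p pi \in unitmx.
Proof.
move=> pP g01; apply: unitmx_col_inj => u.
rewrite mulmxBl mul1mx -scalemxAl => /eqP; rewrite subr_eq0 => /eqP uE.
pose f i := u i ord0.
have fE s : f s = gamma * mean (p s (pi s)) f.
  rewrite -Ppi_mean -mulmx_mean /f {1}uE mxE; congr (_ * (_ *m _) _ _).
  by apply/matrixP => i j; rewrite !mxE ord1.
have KP s : is_prob (p s (pi s)) by exact: kernel_prob.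
apply/matrixP => s j; rewrite ord1 mxE; apply/le_anti/andP; split.
  rewrite -[leRHS](mul0r (1 - gamma)^-1).
  by apply: (subsolution_le (f := f) KP g01) => i; rewrite addr0 -fE.
rewrite -[leLHS](mul0r (1 - gamma)^-1).
by apply: (supersolution_ge (f := f) KP g01) => i; rewrite addr0 -fE.
Qed.

Lemma vpiE (gamma : R) r p pi s : is_kernel p -> 0 <= gamma < 1 ->
  vpi gamma r p pi s =
  r s (pi s) + gamma * mean (p s (pi s)) (vpi gamma r p pi).
Proof.
move=> pP g01; set v := vpi gamma r p pi.
have vE : \col_i v i = invmx (1%:M - gamma *: Ppi p pi) *m rpi r pi.
  by apply/matrixP => i j; rewrite mxE ord1.
have : (1%:M - gamma *: Ppi p pi) *m \col_i v i = rpi r pi.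
  by rewrite vE mulKVmx// resolvent_unit.
rewrite mulmxBl mul1mx -scalemxAl => /eqP; rewrite subr_eq => /eqP/matrixP.
move=> /(_ s ord0); rewrite mxE => ->.
rewrite mxE; congr (_ + _); first by rewrite mxE.
by rewrite mxE mulmx_mean Ppi_mean.
Qed.

(** The policy's Bellman equation cancels the reward, so [f - v] is a subsolution with constant [b],
    of either sign. *)
Lemma le_vpi (gamma b : R) r p pi (f : 'I_nS -> R) : is_kernel p -> 0 <= gamma < 1 ->
  (forall s, f s <= r s (pi s) + gamma * mean (p s (pi s)) f + b) ->
  forall s, f s <= vpi gamma r p pi s + b / (1 - gamma).
Proof.
move=> pP g01 fP s; set v := vpi gamma r p pi.
suff : f s + (-1) * v s <= b / (1 - gamma) by lra.
apply: (subsolution_le (K := fun s => p s (pi s))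
  (f := fun s => f s + (-1) * v s) _ g01) => [i|i]; first exact: kernel_prob.
by rewrite meanD meanZ; have := fP i; have := vpiE r pi i pP g01; rewrite -/v; lra.
Qed.

Lemma ge_vpi (gamma b : R) r p pi (f : 'I_nS -> R) : is_kernel p -> 0 <= gamma < 1 ->
  (forall s, r s (pi s) + gamma * mean (p s (pi s)) f + b <= f s) ->
  forall s, vpi gamma r p pi s + b / (1 - gamma) <= f s.
Proof.
move=> pP g01 fP s; set v := vpi gamma r p pi.
suff : b / (1 - gamma) <= f s + (-1) * v s by lra.
apply: (supersolution_ge (K := fun s => p s (pi s))
  (f := fun s => f s + (-1) * v s) _ g01) => [i|i]; first exact: kernel_prob.
by rewrite meanD meanZ; have := fP i; have := vpiE r pi i pP g01; rewrite -/v; lra.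
Qed.

Lemma vpi_ge0 (gamma : R) r p pi s : is_kernel p -> 0 <= gamma < 1 ->
  (forall s a, 0 <= r s a) -> 0 <= vpi gamma r p pi s.
Proof.
move=> pP g01 r0; rewrite -[leLHS](mul0r (1 - gamma)^-1).
apply: (supersolution_ge (K := fun s => p s (pi s)) _ g01) => i; first exact: kernel_prob.
by rewrite [leRHS]vpiE//; have := r0 i (pi i); lra.
Qed.

Lemma vpi_le (gamma : R) r p pi s : is_kernel p -> 0 <= gamma < 1 ->
  (forall s a, r s a <= 1) -> vpi gamma r p pi s <= 1 / (1 - gamma).
Proof.
move=> pP g01 r1.
apply: (subsolution_le (K := fun s => p s (pi s)) _ g01) => i; first exact: kernel_prob.
by rewrite [leLHS]vpiE//; have := r1 i (pi i); lra.
Qed.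

End PolicyValue.

Section FiniteSup.
Variables (R : realType) (T : finType).
Implicit Types f : T -> R.

Lemma le_sup_fin f x : f x <= sup [set f i | i in [set: T]].
Proof.
apply: ub_le_sup; last by exists x.
by exists (\big[Num.max/f x]_i f i) => _ [i _ <-]; exact: le_bigmax.
Qed.

Lemma sup_fin_le f (x0 : T) (b : R) : (forall x, f x <= b) ->
  sup [set f i | i in [set: T]] <= b.
Proof.
by move=> fb; apply: ge_sup; [exists (f x0), x0 | move=> _ [i _ <-]; exact: fb].
Qed.

Lemma sup_fin_max f x : (forall y, f y <= f x) -> sup [set f i | i in [set: T]] = f x.
Proof. by move=> fx; apply/le_anti; rewrite le_sup_fin sup_fin_le. Qed.

End FiniteSup.

Section ValueGap.
Variables (R : realType) (nS nA : nat) (gamma : R).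
Variables (r : 'I_nS -> 'I_nA -> R) (p : 'I_nS -> 'I_nA -> 'I_nS -> R).
Variables (pi : {ffun 'I_nS -> 'I_nA}).
Hypotheses (pP : is_kernel p) (g01 : 0 <= gamma < 1).

Lemma vpi_le_vstar s : vpi gamma r p pi s <= vstar gamma r p s.
Proof. exact: (le_sup_fin (fun pi => vpi gamma r p pi s)). Qed.

Lemma vstar_gap_trivial s : (forall s a, 0 <= r s a <= 1) ->
  vstar gamma r p s - vpi gamma r p pi s <= 1 / (1 - gamma).
Proof.
move=> r01; have r0 i a : 0 <= r i a by have /andP[] := r01 i a.
have r1 i a : r i a <= 1 by have /andP[] := r01 i a.
have := vpi_ge0 pi s pP g01 r0.
have : vstar gamma r p s <= 1 / (1 - gamma).
  by apply: (sup_fin_le (f := fun pi => vpi gamma r p pi s)) => // pi'; exact: vpi_le.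
lra.
Qed.

End ValueGap.

(** * Minorized chains *)

Lemma bernoulli_ineq (R : realDomainType) (k : nat) (y : R) : 0 <= y ->
  1 + k%:R * y <= (1 + y) ^+ k.
Proof.
move=> y0; elim: k => [|k IHk]; first by rewrite mul0r addr0.
have y1 : 0 <= 1 + y by lra.
have := ler_wpM2l y1 IHk; rewrite -exprS -natr1.
have : 0 <= k%:R * y * y by rewrite !mulr_ge0.
lra.
Qed.

Section Mixing.
Variables (R : realType) (nS : nat) (P : 'M[R]_nS).
Hypothesis P_prob : forall s, is_prob (P s).
Implicit Types (f : 'I_nS -> R).

Lemma mean_mulmx (A B : 'M[R]_nS) f s :
  mean ((A *m B) s) f = mean (A s) (fun i => mean (B i) f).
Proof.
rewrite -[LHS]mulmx_mean -[RHS]mulmx_mean -mulmxA; congr ((_ *m _) _ _).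
by apply/matrixP => i j; rewrite ord1 mulmx_mean mxE.
Qed.

Lemma mean_expS k f s :
  mean ((P ^+ k.+1) s) f = mean (P s) (fun i => mean ((P ^+ k) i) f).
Proof. by rewrite exprS; exact: mean_mulmx. Qed.

Lemma mean_expD k l f s :
  mean ((P ^+ (k + l)) s) f = mean ((P ^+ k) s) (fun i => mean ((P ^+ l) i) f).
Proof. by rewrite exprD; exact: mean_mulmx. Qed.

Lemma mean_exp0 f s : mean ((P ^+ 0) s) f = f s.
Proof. by rewrite -mulmx_mean expr0 mul1mx mxE. Qed.

Lemma exp_prob k s : is_prob ((P ^+ k) s).
Proof.
have mean1 : mean ((P ^+ k) s) (fun=> 1) = 1.
  elim: k s => [|k IHk] s; first by rewrite mean_exp0.
  by rewrite mean_expS (_ : (fun i => _) = (fun=> 1)) ?mean_cst//; exact/funext.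
split=> [s'|]; last first.
  by rewrite -[RHS]mean1; apply: eq_bigr => i _; rewrite mulr1.
elim: k s s' {mean1} => [|k IHk] s s'; first by rewrite expr0 mxE ler0n.
by rewrite exprS mxE; apply: sumr_ge0 => i _; rewrite mulr_ge0//; case: (P_prob s).
Qed.

(** The drift accumulates as [k * b]: over one mixing block this costs the block length and not the
    horizon. *)
Lemma subsolution_iter (gamma b : R) f k : 0 <= gamma <= 1 -> 0 <= b ->
  (forall s, f s <= b + gamma * mean (P s) f) ->
  forall s, f s <= k%:R * b + gamma ^+ k * mean ((P ^+ k) s) f.
Proof.
move=> /andP[g0 g1] b0 fP; elim: k => [|k IHk] s; first by rewrite mean_exp0 mul0r add0r mul1r.
set y := mean ((P ^+ k.+1) s) f.
have : mean (P s) f <= k%:R * b + gamma ^+ k * y.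
  rewrite /y mean_expS -meanZ addrC -meanDc//; apply: mean_le; first by case: (P_prob s).
  by move=> i; rewrite addrC; exact: IHk.
move=> /(ler_wpM2l g0); have := fP s.
have : gamma * (k%:R * b) <= k%:R * b by rewrite ler_piMl// mulr_ge0.
by rewrite -natr1 (exprS gamma) -mulrA; lra.
Qed.

Lemma supersolution_iter (gamma b : R) f k : 0 <= gamma <= 1 -> 0 <= b ->
  (forall s, gamma * mean (P s) f - b <= f s) ->
  forall s, gamma ^+ k * mean ((P ^+ k) s) f - k%:R * b <= f s.
Proof.
move=> g01 b0 fP s; have mN q : mean q (fun i => (-1) * f i) = - mean q f.
  by rewrite meanZ mulN1r.
have fN i : (-1) * f i <= b + gamma * mean (P i) (fun i => (-1) * f i).
  have := fP i; rewrite mN; lra.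
by have := subsolution_iter (f := fun i => (-1) * f i) k g01 b0 fN s; rewrite mN; lra.
Qed.

(** Dobrushin's coefficient of [P ^+ m] is at most [1 - q]. Unlike minorization, this form iterates
    over blocks without exhibiting a new measure. *)
Definition contracts (m : nat) (q : R) := forall f (c : R),
  (forall s s', f s - f s' <= c) ->
  forall s s', mean ((P ^+ m) s) f - mean ((P ^+ m) s') f <= (1 - q) * c.

(* Both rows dominate [q psi], and the remainders have the same mass [1 - q]. *)
Lemma minorizes_contracts m q psi : minorizes P m q psi -> contracts m q.
Proof.
case=> _ [/andP[q0 q1] [psiP PP]] f c fc s s'.
pose s0 := [arg min_(i < s) f i]%O.
have s0P i : f s0 <= f i by rewrite /s0; case: arg_minP => // j _; apply.
have split i g : mean ((P ^+ m) i) g - q * mean psi g =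
    mean (fun j => (P ^+ m) i j - q * psi j) g.
  by rewrite /mean mulr_sumr -sumrB; apply: eq_bigr => j _; ring.
have mass i (d : R) : mean (fun j => (P ^+ m) i j - q * psi j) (fun=> d) = (1 - q) * d.
  rewrite -split !mean_cst//; [ring | exact: exp_prob].
have rest0 i j : 0 <= (P ^+ m) i j - q * psi j by rewrite subr_ge0.
have up : mean (fun j => (P ^+ m) s j - q * psi j) f <= (1 - q) * (f s0 + c).
  by rewrite -(mass s); apply: mean_le => // i; have := fc i s0; lra.
have lo : (1 - q) * f s0 <= mean (fun j => (P ^+ m) s' j - q * psi j) f.
  by rewrite -(mass s'); apply: mean_le.
have := split s f; have := split s' f; lra.
Qed.

Lemma contracts_iter m q k : contracts m q -> contracts (m * k) (1 - (1 - q) ^+ k).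
Proof.
move=> mq; elim: k => [|k IHk] f c fc s s'.
  by rewrite muln0 !mean_exp0; have := fc s s'; lra.
rewrite mulnS !mean_expD subKr exprS -mulrA.
by apply: mq => i j; have := IHk f c fc i j; rewrite subKr.
Qed.

(* With [k = ceil (1 / q)] repetitions, Bernoulli's inequality gives
   [(1 - q) ^ (k - 1) <= 1 / 2]. *)
Lemma minorizes_block m q psi : minorizes P m q psi ->
  exists m' q', [/\ 1 / 2 <= q', q' <= 1, m'%:R <= 2 * q' * (m%:R / q) & contracts m' q'].
Proof.
move=> mq; have [m1 [/andP[q0 q1] _]] := mq.
(* [q = 1] is treated apart because the argument below divides by [1 - q]. *)
have [q_1|q_lt1] : q = 1 \/ q < 1 by move: q1; rewrite le_eqVlt => /orP[/eqP|]; [left|right].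
  exists m, q; split=> //; [lra | | exact: minorizes_contracts mq].
  by rewrite q_1 divr1 mulr1 ler_peMl// ler1n.
pose k := Num.truncn q^-1.
have /truncn_itv/andP[kle klt] : 0 <= q^-1 by rewrite invr_ge0 ltW.
exists (m * k.+1)%N, (1 - (1 - q) ^+ k.+1).
have q'0 : 0 < 1 - q by lra.
have kq1 : k%:R * q <= 1 by rewrite -ler_pdivlMr// mul1r.
have kq2 : 1 < k%:R * q + q by rewrite -{2}[q]mul1r -mulrDl -ltr_pdivrMr// div1r natr1.
have half : (1 - q) ^+ k <= 1 / 2.
  have bern : 2 <= ((1 - q)^-1) ^+ k.
    apply: (@le_trans _ _ (1 + k%:R * (q / (1 - q)))).
      by rewrite -lerBlDl mulrA ler_pdivlMr//; lra.
    apply: le_trans (bernoulli_ineq k _) _; first by rewrite divr_ge0// ltW.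
    by rewrite le_eqVlt; apply/orP; left; apply/eqP; congr (_ ^+ _); field; lra.
  rewrite exprVn in bern; rewrite -[leLHS]invrK div1r lef_pV2// ?posrE ?invr_gt0 ?exprn_gt0//.
have e : (1 - q) ^+ k.+1 <= (1 - q) / 2 by rewrite exprS; nra.
have e0 : 0 <= (1 - q) ^+ k.+1 by rewrite exprn_ge0 // ltW.
split; [lra | lra | | exact/contracts_iter/minorizes_contracts/mq].
(* It suffices that [(k + 1) q <= 1 + q <= 2 q']: the first holds as [k q <= 1], the second as the
   remainder is at most [(1 - q) / 2]. *)
rewrite natrM -natr1 mulrA ler_pdivlMr//.
have : 0 <= m%:R :> R by []. nra.
Qed.

(* [F] plays the role of a bounded corrector: the drift of [v] is only
   controlled up to the coboundary [F - gamma P F]. *)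
Lemma osc_le (gamma b0 b1 B M : R) v F m q : 0 <= gamma <= 1 ->
  contracts m q -> q <= 1 -> 0 <= b0 -> 0 <= b1 ->
  (forall s, 0 <= F s <= B) -> (forall s s', v s - v s' <= M) -> 0 <= M ->
  (forall s, v s - F s <= b1 + gamma * (mean (P s) v - mean (P s) F)) ->
  (forall s, gamma * (mean (P s) v + mean (P s) F) - b0 <= v s + F s) ->
  forall s s', v s - v s' <= 2 * B + m%:R * (b0 + b1) + (1 - q) * M.
Proof.
move=> g01 mq q1 b00 b10 FB vM M0 up lo s s'; have /andP[g0 g1] := g01.
have meanB Q : mean Q (fun i => v i + (-1) * F i) = mean Q v - mean Q F.
  by rewrite meanD meanZ mulN1r.
have up' i : v i + (-1) * F i <= b1 + gamma * mean (P i) (fun i => v i + (-1) * F i).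
  by rewrite meanB; have := up i; lra.
have lo' i : gamma * mean (P i) (fun i => v i + F i) - b0 <= v i + F i.
  by rewrite meanD; have := lo i; lra.
have := subsolution_iter m g01 b10 up' s; rewrite meanB.
have := supersolution_iter m g01 b00 lo' s'; rewrite meanD.
have FP i : 0 <= mean ((P ^+ m) i) F.
  by apply: mean_geC; [exact: exp_prob | move=> j; have /andP[] := FB j].
have := mq v M vM s s'.
set x := mean ((P ^+ m) s) v; set y := mean ((P ^+ m) s') v.
have := FP s; have := FP s'.
set Fs := mean ((P ^+ m) s) F; set Fs' := mean ((P ^+ m) s') F.
move=> Fs'0 Fs0 xy lo1 up1.
have gm0 : 0 <= gamma ^+ m by exact: exprn_ge0.
have gm1 : gamma ^+ m <= 1 by exact: exprn_ile1.
have := FB s; have := FB s'; move=> /andP[? ?] /andP[? ?].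
have qM : 0 <= (1 - q) * M by rewrite mulr_ge0//; lra.
have : gamma ^+ m * (x - y) <= (1 - q) * M.
  apply: (@le_trans _ _ (gamma ^+ m * ((1 - q) * M))); last by rewrite ler_piMl.
  exact: ler_wpM2l.
have : 0 <= gamma ^+ m * Fs by exact: mulr_ge0.
have : 0 <= gamma ^+ m * Fs' by exact: mulr_ge0.
lra.
Qed.

End Mixing.

(** * The minorization time *)

Section Tminorize.
Variables (R : realType) (nS nA : nat) (p : 'I_nS -> 'I_nA -> 'I_nS -> R).
Hypothesis p_erg : uniformly_ergodic p.

Lemma tminorize_mx_inf (pi : {ffun 'I_nS -> 'I_nA}) :
  has_inf [set x : R | exists m q psi, minorizes (Ppi p pi) m q psi /\ x = m%:R / q].
Proof.
split; first by have [m [q [psi mq]]] := p_erg pi; exists (m%:R / q), m, q, psi.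
exists 0 => _ [m [q [psi [[_ [/andP[q0 _] _]] ->]]]].
by rewrite divr_ge0// ltW.
Qed.

Lemma tminorize_ge1 (pi : {ffun 'I_nS -> 'I_nA}) : 1 <= tminorize p.
Proof.
apply: le_trans (le_sup_fin (fun pi => tminorize_mx (Ppi p pi)) pi).
have [S0 _] := tminorize_mx_inf pi.
apply: lb_le_inf => // _ [m [q [psi [[m1 [/andP[q0 q1] _]] ->]]]].
by rewrite ler_pdivlMr// mul1r (le_trans q1)// ler1n.
Qed.

(** A near-minimizer suffices later, so attainment of the infimum is not discussed. *)
Lemma tminorize_approx (pi : {ffun 'I_nS -> 'I_nA}) (e : R) : 0 < e ->
  exists m q psi, minorizes (Ppi p pi) m q psi /\ m%:R / q <= tminorize p + e.
Proof.
move=> e0; have [_ [m [q [psi [mq ->]]]] le_e] := inf_adherent e0 (tminorize_mx_inf pi).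
exists m, q, psi; split=> //; apply: (le_trans (ltW le_e)).
by rewrite lerD2r; exact: (le_sup_fin (fun pi => tminorize_mx (Ppi p pi))).
Qed.

End Tminorize.

(** * The deterministic error bound *)

Section SelfBound.
Variable R : realType.

(* [g^2 Var = g^2 Pu^2 - (u - h)^2 <= g Pu^2 - u^2 + 2 u h], and [h + e + k >= 0] lets
   [u] be replaced by its upper bound [M]; the resulting [40 x e] is absorbed on the
   left since [x <= 1 / 486]. *)
Lemma variance_self_bound (gamma x M a k e u Pu Pu2 : R) :
  1 / 2 <= gamma < 1 -> 0 <= x <= 1 / 486 -> 0 < M -> 0 <= a -> 0 <= k <= 3 / 2 ->
  0 <= u <= M -> 0 <= Pu2 -> Pu ^+ 2 <= Pu2 -> 0 <= e ->
  0 <= u - gamma * Pu + k + e ->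
  e <= a + 5 * (x / M) * (Pu2 - Pu ^+ 2) ->
  e <= 109 / 100 * (a + 60 * x) +
       218 / 10 * (x / M) * (gamma * (Pu2 - 2 * M * Pu) - (u ^+ 2 - 2 * M * u)).
Proof.
move=> /andP[g0 g1] /andP[x0 x1] M0 a0 /andP[k0 k1] /andP[u0 u1] Pu20 var0 e0 he eV.
set y := x / M in eV *.
have y0 : 0 <= y by rewrite divr_ge0// ltW.
have yM : y * M = x by rewrite /y divfK// gt_eqF.
set h := u - gamma * Pu in he *.
set W := gamma * (Pu2 - 2 * M * Pu) - (u ^+ 2 - 2 * M * u).
have V4 : Pu2 - Pu ^+ 2 <= 4 * (W + 2 * M * (k + e)).
  have V1 : gamma ^+ 2 * (Pu2 - Pu ^+ 2) <= gamma * Pu2 - u ^+ 2 + 2 * u * h.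
    have : gamma ^+ 2 * Pu2 <= gamma * Pu2 by rewrite ler_wpM2r// expr2; nra.
    have : 0 <= h ^+ 2 by exact: sqr_ge0.
    by rewrite /h; lra.
  (* The factor 4 is the price of [gamma >= 1 / 2]. *)
  have V2 : (1 / 4) * (Pu2 - Pu ^+ 2) <= gamma ^+ 2 * (Pu2 - Pu ^+ 2).
    by rewrite ler_wpM2r ?subr_ge0// expr2; nra.
  have V3 : u * h <= M * (h + k + e).
    have : u * (h + k + e) <= M * (h + k + e) by rewrite ler_wpM2r.
    have : 0 <= u * (k + e) by rewrite mulr_ge0//; lra.
    lra.
  rewrite /W; rewrite /h in V1 V3 *; lra.
have V5 : y * (Pu2 - Pu ^+ 2) <= 4 * (y * W) + 8 * (x * (k + e)).
  have := ler_wpM2l y0 V4; rewrite -yM; lra.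
have xk : x * k <= 3 / 2 * x by nra.
have xe : x * e <= e / 486 by nra.
(* Here 60 is [40 * 3 / 2]; dividing by [1 - 40 / 486] costs a factor below [109 / 100], which turns
   20 into [218 / 10]. *)
have e1 : (1 - 40 / 486) * e <= a + 60 * x + 20 * (y * W) by lra.
lra.
Qed.

End SelfBound.

Section Oscillation.
Variables (R : realType) (nS : nat) (t : R).
Implicit Types f : 'I_nS -> R.

(** The span seminorm floored at [t], hence a safe denominator whenever [t] is positive. *)
Definition osc f : R := \big[Num.max/t]_(ij : 'I_nS * 'I_nS) (f ij.1 - f ij.2).

Lemma osc_ge f : t <= osc f.
Proof. exact: bigmax_ge_id. Qed.

Lemma osc_sub f i j : f i - f j <= osc f.
Proof. exact: (le_bigmax t (fun ij : 'I_nS * 'I_nS => f ij.1 - f ij.2) (i, j)). Qed.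

Lemma osc_leP f (c : R) : t <= c -> (forall i j, f i - f j <= c) -> osc f <= c.
Proof. by move=> tc fc; apply: bigmax_le => // -[i j] _; exact: fc. Qed.

Lemma osc_dist f g (e : R) : 0 <= e -> (forall i, `|f i - g i| <= e) ->
  osc f <= osc g + 2 * e.
Proof.
move=> e0 fg; apply: osc_leP => [|i j]; first by have := osc_ge g; lra.
have := osc_sub g i j; have := fg i; have := fg j.
by rewrite !ler_norml => /andP[? ?] /andP[? ?]; lra.
Qed.

End Oscillation.

(** * Loss of the empirical greedy policy, given the deviation bounds *)

Section EmpiricalPolicy.
Variables (R : realType) (nS nA : nat) (gamma zeta x : R).
Variables (r Rw : 'I_nS -> 'I_nA -> R) (p ph : 'I_nS -> 'I_nA -> 'I_nS -> R).
Variables (v : 'I_nS -> R) (pi : {ffun 'I_nS -> 'I_nA}).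
Let t : R := tminorize p.

Hypotheses (nS_gt0 : (0 < nS)%N) (gammaP : 1 / 2 <= gamma < 1).
Hypotheses (rP : forall s a, 0 <= r s a <= 1) (zetaP : 0 < zeta < 1 / 2).
Hypothesis RwP : forall s a, r s a <= Rw s a <= r s a + zeta.
Hypotheses (pP : is_kernel p) (phP : is_kernel ph) (p_erg : uniformly_ergodic p).
Hypotheses (t_le : t <= (1 - gamma)^-1) (xP : 0 <= x <= 1 / 486).
Hypothesis v_ge : forall s a, Rw s a + gamma * mean (ph s a) v <= v s.
Hypothesis vE : forall s, v s = Rw s (pi s) + gamma * mean (ph s (pi s)) v.
(** The only probabilistic input. The surrogate [w] stands for [v] because [v] depends on the
    samples drawn at [(s, a)]; the two terms are those of Bernstein's inequality with exponent
    [x / osc t w]. *)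
Hypothesis deviation : forall s a, exists w : 'I_nS -> R,
  (forall i, `|v i - w i| <= zeta / 8) /\
  `|mean (ph s a) w - mean (p s a) w| <=
    x * osc t w / (2 * t) + 2 * x / osc t w * variance (p s a) w.

Let M : R := osc t v.
Let g01 : 0 <= gamma < 1. Proof. by have /andP[? ?] := gammaP; lra. Qed.
Let t_ge1 : 1 <= t. Proof. exact: tminorize_ge1. Qed.
Let M_ge_t : t <= M. Proof. exact: osc_ge. Qed.

Lemma greedy_value_ge0 s : 0 <= v s.
Proof.
rewrite -(mul0r (1 - gamma)^-1).
apply: (supersolution_ge (K := fun s => ph s (pi s)) _ g01) => i; first exact: kernel_prob.
by have := vE i; have /andP[? _] := RwP i (pi i); have /andP[? _] := rP i (pi i); lra.
Qed.

Lemma greedy_value_le s : v s <= (3 / 2) / (1 - gamma).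
Proof.
apply: (subsolution_le (K := fun s => ph s (pi s)) _ g01) => i; first exact: kernel_prob.
have := vE i; have /andP[_ ?] := RwP i (pi i); have /andP[_ ?] := rP i (pi i).
by have /andP[? ?] := zetaP; lra.
Qed.

(** [6 / 10] covers [9 / 16] from the tail term and [1 / 56] from the variance of [w]; [zeta / 4]
    pays for exchanging [v] and [w] in both averages. *)
Let a1 : R := 6 / 10 * (x * M / t) + zeta / 4.

Let deviation_v s a : `|mean (ph s a) v - mean (p s a) v| <=
  a1 + 5 * (x / M) * variance (p s a) v.
Proof.
have [w [vw dev]] := deviation s a; have /andP[z0 z1] := zetaP; have /andP[x0 _] := xP.
have wv i : `|w i - v i| <= zeta / 8 by rewrite distrC.
have z8 : 0 <= zeta / 8 by lra.
have Mw1 := osc_dist t z8 wv; have Mw2 := osc_dist t z8 vw; rewrite -/M in Mw1 Mw2.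
have Mw0 := osc_ge t w; set Mw := osc t w in Mw0 Mw1 Mw2 dev.
have Vw := variance_perturb (kernel_prob s a pP) wv.
have V0 := variance_ge0 v (kernel_prob s a pP).
set Vv := variance (p s a) v in V0 Vw *; set Vw' := variance _ w in dev Vw.
have d1 := mean_dist (kernel_prob s a phP) vw.
have d2 := mean_dist (kernel_prob s a pP) wv.
have t1 := t_ge1; have Mt := M_ge_t.
have M1 : 1 <= M by exact: le_trans Mt.
(* [osc t w] is within [zeta / 4 <= 1 / 8] of [M >= 1], hence between [7 / 8] and [9 / 8] of [M]. *)
have iMw : Mw^-1 <= 8 / 7 * M^-1.
  by rewrite ler_pdivlMr ?[_ * M]mulrC ?ler_pdivrMr; lra.
have t0 : 0 < t by lra.
have xt0 : 0 <= x / t by rewrite divr_ge0// ltW.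
have xt1 : x * Mw / (2 * t) <= 9 / 16 * (x / t * M).
  rewrite invfM; have : x / t * Mw <= x / t * (9 / 8 * M) by rewrite ler_wpM2l//; lra.
  lra.
have xt2 : x <= x / t * M by rewrite mulrAC -mulrA ler_peMr// ler_pdivlMr// mul1r.
have xV : 2 * x / Mw * Vw' <= 5 * (x / M) * Vv + x / 56.
  have : x / Mw <= x * (8 / 7 * M^-1) by rewrite ler_wpM2l.
  have xMw0 : 0 <= x / Mw by rewrite divr_ge0//; lra.
  have : x / Mw * Vw' <= x / Mw * (2 * Vv + 2 * (zeta / 8) ^+ 2) by rewrite ler_wpM2l.
  have : (zeta / 8) ^+ 2 <= 1 / 256 by rewrite expr2; nra.
  have xM : x / M <= x by rewrite ler_piMr// invf_le1; lra.
  move=> zz xMw1 xMw2.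
  have : x / Mw * (2 * Vv + 2 * (zeta / 8) ^+ 2) <= x * (8 / 7 * M^-1) * (2 * Vv + 2 / 256).
    by apply: ler_pM => //; [have := sqr_ge0 (zeta / 8); lra | lra].
  have : 0 <= x / M * Vv by rewrite mulr_ge0// divr_ge0//; lra.
  lra.
move: d1 d2 dev; rewrite /a1 !ler_norml -[x * M / t]mulrAC.
by move=> /andP[? ?] /andP[? ?] /andP[? ?]; apply/andP; split; lra.
Qed.

Let s0 : 'I_nS := [arg min_(i < Ordinal nS_gt0) v i]%O.
Let u i : R := v i - v s0.
(* [- M ^ 2 <= G <= 0], and the conditional variance of [v] is at most a constant multiple of
   [M] plus [gamma P G - G], for every policy at once: [G] is a Lyapunov function. *)
Let G i : R := u i ^+ 2 - 2 * M * u i.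
Let kappa : R := 218 / 10 * (x / M).
Let a2 : R := 109 / 100 * (a1 + 60 * x).

Let uP i : 0 <= u i <= M.
Proof.
rewrite /u osc_sub andbT subr_ge0 /s0.
by case: arg_minP => // j _; apply.
Qed.

Let GP i : - M ^+ 2 <= G i <= 0.
Proof.
have /andP[u0 u1] := uP i; rewrite /G; apply/andP; split; last by nra.
by have := sqr_ge0 (u i - M); lra.
Qed.

Let a1_ge0 : 0 <= a1.
Proof.
have /andP[x0 _] := xP; have /andP[z0 _] := zetaP; rewrite /a1.
have t1 := t_ge1; have Mt := M_ge_t.
have : 0 <= x * M / t by rewrite divr_ge0 ?mulr_ge0//; lra.
lra.
Qed.

Let drift s a : `|mean (ph s a) v - mean (p s a) v| <=
  a2 + kappa * (gamma * mean (p s a) G - G s).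
Proof.
set e := `|_|; have ps := kernel_prob s a pP; have /andP[g0 g1] := gammaP.
have meanu : mean (p s a) u = mean (p s a) v - v s0 by rewrite /u meanDc.
have -> : mean (p s a) G = mean (p s a) (fun i => u i ^+ 2) - 2 * M * mean (p s a) u.
  by rewrite /G -mulNr -meanZ -meanD; congr mean; apply/funext => i; rewrite mulNr.
(* Shifting [v] by its minimum adds this constant to the Bellman inequality; it stays bounded
   uniformly in the horizon. *)
have vs0 : 0 <= (1 - gamma) * v s0 <= 3 / 2.
  have := greedy_value_ge0 s0; have := greedy_value_le s0.
  rewrite ler_pdivlMr ?subr_gt0// mulrC => -> ?.
  by rewrite mulr_ge0//; lra.
have Vu : variance (p s a) v = mean (p s a) (fun i => u i ^+ 2) - mean (p s a) u ^+ 2.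
  by rewrite -(variance_shift v (- v s0) ps).
have u2 : 0 <= mean (p s a) (fun i => u i ^+ 2) by apply: mean_geC => // i; exact: sqr_ge0.
have M0 : 0 < M by have := t_ge1; have := M_ge_t; lra.
apply: (variance_self_bound gammaP xP M0 a1_ge0 vs0 (uP s) u2) => //.
- by have := variance_ge0 v ps; rewrite Vu subr_ge0.
- exact: normr_ge0.
(* The quantity is [v - gamma p v + e]; it is nonnegative since [v - gamma ph v >= Rw >= 0] and
   exchanging [ph] and [p] costs at most [e]. *)
- have := v_ge s a; have /andP[? _] := RwP s a; have /andP[? _] := rP s a.
  have : - e <= gamma * (mean (ph s a) v - mean (p s a) v).
    have e0 : 0 <= e by exact: normr_ge0.
    rewrite lerNl -mulrN; apply: (@le_trans _ _ (gamma * e)); last by nra.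
    rewrite ler_wpM2l//; first by lra.
    by rewrite /e -normrN; exact: ler_norm.
  by rewrite meanu /u; lra.
- by rewrite -Vu; exact: deviation_v.
Qed.

Let a2_ge0 : 0 <= a2.
Proof. by have a0 := a1_ge0; have /andP[x0 _] := xP; rewrite /a2; lra. Qed.

Let kappa_ge0 : 0 <= kappa.
Proof.
have /andP[x0 _] := xP; have t1 := t_ge1; have Mt := M_ge_t.
by rewrite /kappa mulr_ge0 ?divr_ge0//; lra.
Qed.

Let kappaM : kappa * M ^+ 2 = 218 / 10 * (x * M).
Proof.
have t1 := t_ge1; have Mt := M_ge_t.
by rewrite /kappa; field; apply/eqP; lra.
Qed.

Let kappaGP s : - (218 / 10 * (x * M)) <= kappa * G s <= 0.
Proof.
have /andP[G0 G1] := GP s; have k0 := kappa_ge0.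
by rewrite -kappaM -mulrN ler_wpM2l//= mulr_ge0_le0.
Qed.

(** Passing from [ph] to [p] costs at most the bound in [drift], whose [kappa] part telescopes into
    the correction [- kappa * G]. Valid for every action, so it can be compared with every
    policy. *)
Let lower_drift s a : r s a + gamma * (mean (p s a) v - kappa * mean (p s a) G) - a2 <=
  v s - kappa * G s.
Proof.
have := v_ge s a; have /andP[? _] := RwP s a; have := drift s a.
have /andP[g0 g1] := g01; set e := _ - _ => ed.
have : - `|e| <= gamma * e.
  have := normr_ge0 e; have := ler_norm (- e); rewrite normrN => e1 e2.
  have : gamma * - e <= gamma * `|e| by rewrite ler_wpM2l.
  have : gamma * `|e| <= `|e| by rewrite ler_piMl// ltW.
  lra.
rewrite /e in ed *; lra.
Qed.

(** The mirror estimate, with the sign of [G] reversed, along the greedy action only; [zeta] bounds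
    the perturbation of the reward. *)
Let upper_drift s : v s + kappa * G s <= r s (pi s) +
  gamma * (mean (p s (pi s)) v + kappa * mean (p s (pi s)) G) + (zeta + a2).
Proof.
have := vE s; have /andP[_ ?] := RwP s (pi s); have := drift s (pi s).
have /andP[g0 g1] := g01; set e := _ - _ => ed.
have : gamma * e <= `|e|.
  apply: (@le_trans _ _ (gamma * `|e|)); first by rewrite ler_wpM2l// ler_norm.
  by rewrite ler_piMl// ltW.
rewrite /e in ed *; lra.
Qed.

(** The two drift bounds feed [osc_le] with [F = - kappa * G] along the greedy policy's true chain.
    The resulting bound contains [M] itself, with coefficients small enough to absorb since
    [x <= 1 / 486]. *)
Let M_le : M <= 51 / 10 * t.
Proof.
have t1 := t_ge1; have Mt := M_ge_t; have /andP[x0 x1] := xP; have a0 := a2_ge0.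
have /andP[z0 z1] := zetaP; have /andP[g0 g1] := g01.
have t0 : 0 < t by lra.
have e0 : 0 < t / 100 by lra.
have [m [q [psi [mq mq_le]]]] := tminorize_approx p_erg pi e0.
have P_prob i : is_prob (Ppi p pi i) by exact: Ppi_prob.
have [m' [q' [q'1 q'2 m'le mq']]] := minorizes_block P_prob mq.
have vosc : forall s s', v s - v s' <= 2 * (kappa * M ^+ 2) +
    m'%:R * (a2 + (3 / 2 + a2)) + (1 - q') * M.
  apply: (osc_le (gamma := gamma) (F := fun i => (- kappa) * G i) P_prob _ mq') => //.
  - by rewrite g0 ltW.
  - lra.
  - by move=> i; have /andP[? ?] := kappaGP i; rewrite kappaM; apply/andP; split; lra.
  - by move=> i j; exact: osc_sub.
  - lra.
  - move=> i; rewrite meanZ !Ppi_mean; have := upper_drift i.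
    by have /andP[_ ?] := rP i (pi i); lra.
  - move=> i; rewrite meanZ !Ppi_mean; have := lower_drift i (pi i).
    by have /andP[? _] := rP i (pi i); lra.
have : M <= Num.max t (2 * (kappa * M ^+ 2) + m'%:R * (a2 + (3 / 2 + a2)) + (1 - q') * M).
  by apply: osc_leP => [|i j]; rewrite le_max ?lexx// vosc orbT.
rewrite le_max => /orP[|]; first by lra.
rewrite kappaM => M1; set b := a2 + _ in M1.
have b0 : 0 <= b by rewrite /b; lra.
have m'b : m'%:R * b <= 2 * q' * (t + t / 100) * b.
  rewrite ler_wpM2r//; apply: (le_trans m'le); rewrite ler_wpM2l//; lra.
have xM : x * M <= M / 486.
  have : x * M <= 1 / 486 * M by rewrite ler_wpM2r//; lra.
  lra.
have tb : t * b <= t * (3 / 2) + 109 / 50 * (6 / 10 * (M / 486) + t / 8 + 60 * t / 486).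
  have -> : t * b = t * (3 / 2) + 109 / 50 * (6 / 10 * (x * M) + t * zeta / 4 + 60 * (x * t)).
    by rewrite /b /a2 /a1; field; apply/eqP; lra.
  have : t * zeta <= t * (1 / 2) by rewrite ler_wpM2l//; lra.
  have : x * t <= 1 / 486 * t by rewrite ler_wpM2r//; lra.
  lra.
(* This brings a factor [q'] into every term, so that [q'] cancels at the end. *)
have q'M : M <= 2 * (q' * M) by rewrite mulrA ler_peMl//; lra.
have q'0 : 0 < q' by lra.
have q'tb := ler_wpM2l (ltW q'0) tb.
have : q' * M <= q' * (51 / 10 * t).
  lra.
by rewrite ler_pM2l.
Qed.

(** The comparison principles sandwich [v]: every policy value lies below [v - kappa * G], the
    greedy one above [v + kappa * G], up to constants, and [G] is bounded by [M ^+ 2]. *)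
Lemma greedy_policy_gap s : vstar gamma r p s - vpi gamma r p pi s <=
  2 * zeta / (1 - gamma) + 486 * x / (1 - gamma).
Proof.
have /andP[g0 g1] := g01; have /andP[x0 x1] := xP; have /andP[z0 z1] := zetaP.
have t1 := t_ge1; have Mt := M_ge_t; have Ml := M_le.
set H := (1 - gamma)^-1.
have up : v s + kappa * G s <= vpi gamma r p pi s + (zeta + a2) / (1 - gamma).
  apply: (le_vpi (f := fun i => v i + kappa * G i)) => // i.
  by rewrite meanD meanZ; exact: upper_drift.
have lo : vstar gamma r p s <= v s + (- kappa) * G s - - a2 / (1 - gamma).
  apply: (sup_fin_le (f := fun pi => vpi gamma r p pi s) pi) => pi'.
  rewrite lerBrDr; apply: (ge_vpi (f := fun i => v i + (- kappa) * G i)) => // i.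
  by rewrite meanD meanZ; have := lower_drift i (pi' i); lra.
have /andP[kG _] := kappaGP s.
have H0 : 0 <= H by rewrite invr_ge0; lra.
have xM : x * M <= 51 / 10 * (x * H).
  have : x * M <= x * (51 / 10 * H) by rewrite ler_wpM2l// (le_trans Ml)// ler_wpM2l.
  lra.
have a2H : a2 <= 109 / 100 * (306 / 100 * x + zeta / 4 + 60 * x).
  have : x * M / t <= 51 / 10 * x.
    rewrite ler_pdivrMr; last by lra.
    by have : x * M <= x * (51 / 10 * t) by [rewrite ler_wpM2l|]; lra.
  rewrite /a2 /a1; lra.
(* The total is about [360 * x * H + 1.55 * zeta * H], within the claimed constants. *)
have := ler_wpM2r H0 a2H; rewrite -/H in up lo *.
have : 0 <= zeta * H by rewrite mulr_ge0// ltW.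
have : 0 <= x * H by rewrite mulr_ge0.
lra.
Qed.

End EmpiricalPolicy.

(** * Concentration for finite samples *)

Section Bernstein.
Variables (R : realType) (nS : nat) (q : 'I_nS -> R).
Hypothesis qP : is_prob q.

(** Inverting [1 - y <= expR (- y)] reduces the claim to [(1 + y + 2 y^2) (1 - y) = 1 + y^2 (1 - 2
    y) >= 1]. *)
Lemma expR_le_quadratic (y : R) : y <= 1 / 2 -> expR y <= 1 + y + 2 * y ^+ 2.
Proof.
move=> y1; have e1 : 0 < 1 - y by lra.
have eN : 1 - y <= expR (- y) by have := expR_ge1Dx (- y); lra.
rewrite -[leLHS]invrK -expRN; apply: (@le_trans _ _ (1 - y)^-1).
  by rewrite lef_pV2 ?posrE ?expR_gt0.
rewrite -[leLHS]mul1r ler_pdivrMr//.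
have : 0 <= y ^+ 2 * (1 - 2 * y) by rewrite mulr_ge0 ?sqr_ge0//; lra.
rewrite !expr2; lra.
Qed.

Lemma mgf_le (f : 'I_nS -> R) : mean q f = 0 -> (forall s, f s <= 1 / 2) ->
  mean q (fun s => expR (f s)) <= expR (2 * mean q (fun s => f s ^+ 2)).
Proof.
move=> f0 f1; apply: le_trans (expR_ge1Dx _).
apply: (@le_trans _ _ (mean q (fun s => (f s + 2 * f s ^+ 2) + 1))).
  apply: mean_le => [|s]; first by case: qP.
  by have := expR_le_quadratic (f1 s); lra.
by rewrite meanDc// meanD meanZ f0; lra.
Qed.

(** Exponential Markov inequality on the finite product space; the usual free exponent is already
    absorbed in the scale of [f]. *)
Lemma chernoff (f : 'I_nS -> R) (n : nat) (B : R) :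
  mean q f = 0 -> (forall s, f s <= 1 / 2) ->
  \sum_(c : {ffun 'I_n -> 'I_nS}) (\prod_j q (c j)) *
    (B + n%:R * (2 * mean q (fun s => f s ^+ 2)) < \sum_j f (c j))%R%:R <= expR (- B).
Proof.
move=> f0 f1; set V := 2 * _; have [q0 q1] := qP.
have prod0 (c : {ffun 'I_n -> 'I_nS}) : 0 <= \prod_j q (c j) by apply: prodr_ge0.
apply: (@le_trans _ _ (\sum_(c : {ffun 'I_n -> 'I_nS}) expR (- (B + n%:R * V)) *
    \prod_j (q (c j) * expR (f (c j))))).
  apply: ler_sum => c _; rewrite big_split /= [leRHS]mulrCA ler_wpM2l// -expR_sum -expRD.
  case: ltP => [lt_f|_]; last exact: expR_ge0.
  by rewrite -[leLHS]expR0 ler_expR; lra.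
rewrite -mulr_sumr -(bigA_distr_bigA (fun=> fun s => q s * expR (f s))) /=.
rewrite prodr_const card_ord opprD expRD -mulrA ler_piMr ?expR_ge0//.
rewrite expRN expRM_natl mulrC ler_pdivrMr ?exprn_gt0 ?expR_gt0// mul1r.
by rewrite lerXn2r ?nnegrE ?expR_ge0 ?mgf_le// sumr_ge0// => s _; rewrite mulr_ge0// expR_ge0.
Qed.

Lemma mean_emp (n : nat) (c : 'I_n -> 'I_nS) (f : 'I_nS -> R) :
  mean (emp c) f = (\sum_j f (c j)) / n%:R.
Proof.
rewrite /mean mulr_suml.
transitivity (\sum_(s < nS) \sum_(j < n | c j == s) f s / n%:R).
  apply: eq_bigr => s _; rewrite sumr_const -[RHS]mulr_natr /emp.
  rewrite (_ : #|[set i | c i == s]| = #|[pred j | c j == s]|).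
    by rewrite [LHS]mulrC mulrA mulrAC.
  by apply: eq_card => j; apply/idP/idP; rewrite !inE.
rewrite (exchange_big_dep xpredT)//=; apply: eq_bigr => j _.
by rewrite (big_pred1 (c j)) => // s; rewrite eq_sym.
Qed.

(** Both tails follow from [chernoff] applied to [l (w - mean)] and its negative. The exponent [l]
    stays fixed instead of being optimized, so the variance enters linearly, without a square
    root. *)
Lemma bernstein (w : 'I_nS -> R) (n : nat) (B l : R) : (0 < n)%N -> 0 < l ->
  (forall i j, l * (w i - w j) <= 1 / 2) ->
  \sum_(c : {ffun 'I_n -> 'I_nS}) (\prod_j q (c j)) *
    (B / (n%:R * l) + 2 * l * variance q w < `|mean (emp c) w - mean q w|)%R%:R
  <= 2 * expR (- B).
Proof.
move=> n0 l0 lw; have [q0 q1] := qP; set m := mean q w.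
have n0R : 0 < n%:R :> R by rewrite ltr0n.
pose f s := l * (w s - m); pose g s := (-1) * f s.
have wm s : l * w s - 1 / 2 <= l * m <= l * w s + 1 / 2.
  rewrite -!meanZ mean_leC ?mean_geC// => j.
    by have := lw s j; lra.
  by have := lw j s; lra.
have f0 : mean q f = 0 by rewrite /f meanZ meanDc// subrr mulr0.
have g0 : mean q g = 0 by rewrite /g meanZ f0 mulr0.
have f1 s : f s <= 1 / 2 by have /andP[? ?] := wm s; rewrite /f; lra.
have g1 s : g s <= 1 / 2 by have /andP[? ?] := wm s; rewrite /g /f; lra.
have fV : mean q (fun s => f s ^+ 2) = l ^+ 2 * variance q w.
  rewrite -(variance_shift w (- m) qP) /variance meanDc// subrr expr0n subr0 -meanZ.
  by congr mean; apply/funext => s; rewrite /f exprMn.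
have gV : mean q (fun s => g s ^+ 2) = l ^+ 2 * variance q w.
  by rewrite -fV; congr mean; apply/funext => s; rewrite /g mulN1r sqrrN.
have := chernoff n B f0 f1; have := chernoff n B g0 g1; rewrite fV gV => hg hf.
rewrite [leRHS]mulr_natl mulr2n; apply: le_trans (lerD hf hg).
rewrite -big_split /=; apply: ler_sum => c _; rewrite -mulrDr ler_wpM2l ?prodr_ge0//.
case: ltP => [lt_dev|_]; last by rewrite addr_ge0.
have sf : \sum_j f (c j) = n%:R * l * (mean (emp c) w - m).
  rewrite /f -mulr_sumr sumrB sumr_const card_ord -mulr_natr mean_emp.
  by field; apply/eqP; lra.
have sg : \sum_j g (c j) = - (n%:R * l * (mean (emp c) w - m)).
  by rewrite -sf /g -mulr_sumr mulN1r.
have nl0 : 0 < n%:R * l by rewrite mulr_gt0.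
have key : B + n%:R * (2 * (l ^+ 2 * variance q w)) =
    n%:R * l * (B / (n%:R * l) + 2 * l * variance q w).
  by field; apply/andP; split; apply/eqP; lra.
rewrite key sf sg -mulrN !ltr_pM2l//.
by move: lt_dev; rewrite real_lter_normr ?num_real// => /orP[] ->; rewrite ?lerDl ?lerDr.
Qed.

End Bernstein.

(** * Redrawing the samples of one state-action pair *)

Section Resampling.
Variables (R : realType) (K S : finType) (n : nat) (q : K -> S -> R).
Implicit Types (x y : {ffun K * 'I_n -> S}) (c : {ffun 'I_n -> S}).

Definition sample_weight x : R := \prod_i q i.1 (x i).
Definition row_weight k c : R := \prod_j q k (c j).

Definition row k x : {ffun 'I_n -> S} := [ffun j => x (k, j)].
Definition set_row k x c : {ffun K * 'I_n -> S} :=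
  [ffun i => if i.1 == k then c i.2 else x i].

Lemma row_set_row k x c : row k (set_row k x c) = c.
Proof. by apply/ffunP => j; rewrite !ffunE eqxx. Qed.

Lemma set_rowK k x c : set_row k (set_row k x c) (row k x) = x.
Proof. by apply/ffunP => -[k' j]; rewrite !ffunE /=; case: eqP => // ->. Qed.

Lemma sample_weight_rows x : sample_weight x = \prod_k row_weight k (row k x).
Proof.
rewrite /sample_weight (eq_bigr (fun i => q i.1 (x (i.1, i.2)))); last by case.
rewrite -(pair_bigA _ (fun k j => q k (x (k, j)))) /=.
by apply: eq_bigr => k _; apply: eq_bigr => j _; rewrite ffunE.
Qed.

(** Stated as products because weights may vanish. *)
Lemma set_row_weight k x c : sample_weight (set_row k x c) * row_weight k (row k x) =
  sample_weight x * row_weight k c.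
Proof.
rewrite !sample_weight_rows (bigD1 k)//= [in RHS](bigD1 k)//= row_set_row.
rewrite (eq_bigr (fun k' => row_weight k' (row k' x))) => [|k' kk']; first ring.
by congr row_weight; apply/ffunP => j; rewrite !ffunE (negPf kk').
Qed.

Lemma sum_row_weight k : \sum_s q k s = 1 -> \sum_c row_weight k c = 1.
Proof.
by move=> q1; rewrite -(bigA_distr_bigA (fun=> q k)) /= q1 prodr_const expr1n.
Qed.

Lemma sum_sample_weight : (forall k, \sum_s q k s = 1) -> \sum_x sample_weight x = 1.
Proof.
move=> q1; rewrite -(bigA_distr_bigA (fun i => q i.1)) /=.
by rewrite big1.
Qed.

(* [(x, c) |-> (set_row k x c, row k x)] is a weight-preserving involution. *)
Lemma resample k (F : {ffun K * 'I_n -> S} -> R) : \sum_s q k s = 1 ->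
  \sum_x sample_weight x * F x =
  \sum_x sample_weight x * \sum_c row_weight k c * F (set_row k x c).
Proof.
move=> q1; under eq_bigr => x _.
  rewrite -[sample_weight x]mulr1 -(sum_row_weight q1) mulr_sumr mulr_suml; over.
under [RHS]eq_bigr => x _ do rewrite mulr_sumr.
rewrite !pair_bigA /=.
pose swap (xc : {ffun K * 'I_n -> S} * {ffun 'I_n -> S}) :=
  (set_row k xc.1 xc.2, row k xc.1).
have swapK : involutive swap by case=> x c; rewrite /swap /= set_rowK row_set_row.
rewrite (reindex_inj (inv_inj swapK)) /=; apply: eq_bigr => -[x c] _ /=.
by rewrite set_row_weight mulrA.
Qed.

End Resampling.

(** * Simultaneous deviation bounds *)

Section UnionBound.
Variables (R : realType) (K : finType) (nS n N : nat) (q : K -> 'I_nS -> R) (t x0 : R).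
Variable W : K -> 'I_N -> {ffun K * 'I_n -> 'I_nS} -> 'I_nS -> R.
Hypothesis qP : forall k, is_prob (q k).
Hypotheses (n_gt0 : (0 < n)%N) (t_gt0 : 0 < t) (x0P : 0 < x0 <= 1 / 2).
Hypothesis W_row : forall k j x c, W k j (set_row k x c) = W k j x.

Definition deviates (k : K) (w : 'I_nS -> R) (c : {ffun 'I_n -> 'I_nS}) : bool :=
  x0 * osc t w / (2 * t) + 2 * x0 / osc t w * variance (q k) w <
  `|mean (emp c) w - mean (q k) w|.

(** Bernstein with [l = x0 / osc t w], admissible since [x0 <= 1 / 2], and with [B] chosen so that
    [B / (n l)] is the first term of the threshold. *)
Lemma deviates_prob k w : \sum_c row_weight q k c * (deviates k w c)%:R <=
  2 * expR (- (n%:R * x0 ^+ 2 / (2 * t))).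
Proof.
have /andP[x1 x2] := x0P; have o0 : 0 < osc t w by exact: lt_le_trans (osc_ge t w).
have n0R : 0 < n%:R :> R by rewrite ltr0n.
have l0 : 0 < x0 / osc t w by rewrite divr_gt0.
have lw i j : x0 / osc t w * (w i - w j) <= 1 / 2.
  apply: (@le_trans _ _ (x0 / osc t w * osc t w)); last by rewrite divfK ?gt_eqF.
  by rewrite ler_wpM2l ?osc_sub// ltW.
have := bernstein (qP k) (n%:R * x0 ^+ 2 / (2 * t)) n_gt0 l0 lw.
have -> : n%:R * x0 ^+ 2 / (2 * t) / (n%:R * (x0 / osc t w)) = x0 * osc t w / (2 * t).
  by field; rewrite !gt_eqF.
by rewrite mulrA.
Qed.

(** Redrawing row [k] leaves [W k j] unchanged by [W_row], so conditionally on the other rows the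
    test function is deterministic and [deviates_prob] applies. *)
Lemma union_bound :
  \sum_x sample_weight q x *
    [exists kj : K * 'I_N, deviates kj.1 (W kj.1 kj.2 x) (row kj.1 x)]%:R <=
  (#|K| * N)%:R * (2 * expR (- (n%:R * x0 ^+ 2 / (2 * t)))).
Proof.
set b := 2 * _; have w0 (x : {ffun K * 'I_n -> 'I_nS}) : 0 <= sample_weight q x.
  by apply: prodr_ge0 => i _; case: (qP i.1).
apply: (@le_trans _ _ (\sum_(kj : K * 'I_N) b)); last first.
  by rewrite sumr_const card_prod card_ord -[leLHS]mulr_natl.
apply: (@le_trans _ _ (\sum_(kj : K * 'I_N) \sum_x sample_weight q x *
    (deviates kj.1 (W kj.1 kj.2 x) (row kj.1 x))%:R)).
  rewrite exchange_big; apply: ler_sum => x _; rewrite -mulr_sumr ler_wpM2l//.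
  case: existsP => [[kj dev]|_]; last by apply: sumr_ge0 => kj _; rewrite ler0n.
  by rewrite (bigD1 kj)//= dev lerDl sumr_ge0.
apply: ler_sum => -[k j] _ /=; have [_ qk1] := qP k.
rewrite (resample _ qk1) -[leRHS]mul1r -[X in X * b](sum_sample_weight n (q := q)); last first.
  by move=> k'; case: (qP k').
rewrite mulr_suml; apply: ler_sum => x _; rewrite ler_wpM2l//.
under eq_bigr => c _ do rewrite W_row row_set_row.
exact: deviates_prob.
Qed.

End UnionBound.

(** * Frozen value iteration *)

Section FrozenIteration.
Variables (R : realType) (nS nA : nat) (gamma : R).
Implicit Types (Rw : 'I_nS -> 'I_nA -> R) (ph : 'I_nS -> 'I_nA -> 'I_nS -> R).

(* Value iteration with the value at [s0] frozen to [u]: it does not read the samples drawn at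
   [s0], yet it approximates the empirical optimal value when [u] is close to that value at [s0]. *)
Definition frozen_bellman Rw ph (s0 : 'I_nS) (u : R) (f : 'I_nS -> R) (s : 'I_nS) : R :=
  if s == s0 then u else \big[Num.max/0]_a (Rw s a + gamma * mean (ph s a) f).

Definition frozen_iter Rw ph s0 u J : 'I_nS -> R :=
  iter J (frozen_bellman Rw ph s0 u) (fun=> 0).

Lemma frozen_iter_ext Rw ph ph' s0 u J :
  (forall s a, s != s0 -> ph s a = ph' s a) ->
  frozen_iter Rw ph s0 u J = frozen_iter Rw ph' s0 u J.
Proof.
move=> eq_ph; elim: J => //= J; rewrite /frozen_iter /= => ->.
apply/funext => s; rewrite /frozen_bellman; case: ifPn => // ss0.
by apply: eq_bigr => a _; rewrite eq_ph.
Qed.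

(** Error recursion of a contraction: the reward error [(1 - gamma) * e] is exactly what keeps the
    level [e] stable, while the initial error decays geometrically. *)
Lemma frozen_iter_dist Rw Rk ph s0 u J (v : 'I_nS -> R) (pi : 'I_nS -> 'I_nA) (e V : R) :
  0 <= gamma < 1 -> is_kernel ph -> (forall s, 0 <= v s <= V) -> 0 <= e ->
  (forall s a, Rw s a + gamma * mean (ph s a) v <= v s) ->
  (forall s, v s = Rw s (pi s) + gamma * mean (ph s (pi s)) v) ->
  `|v s0 - u| <= e -> (forall s a, `|Rw s a - Rk s a| <= (1 - gamma) * e) ->
  forall s, `|v s - frozen_iter Rk ph s0 u J s| <= e + gamma ^+ J * V.
Proof.
move=> /andP[g0 g1] phP vV e0 v_ge vE vu RR; elim: J => [|J IHJ] s.
  rewrite /frozen_iter /= subr0 mul1r; have /andP[v0 v1] := vV s.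
  by rewrite ger0_norm//; lra.
have V0 : 0 <= V by have /andP[? ?] := vV s; lra.
rewrite /frozen_iter /= -/(frozen_iter Rk ph s0 u J) /frozen_bellman.
case: eqP => [->|_].
  by apply: (le_trans vu); rewrite lerDl mulr_ge0// exprn_ge0.
set f := frozen_iter _ _ _ _ _ in IHJ *; set d := e + _ in IHJ.
have d' : e + gamma ^+ J.+1 * V = (1 - gamma) * e + gamma * d.
  by rewrite /d exprS; ring.
have dist a : `|gamma * mean (ph s a) v - gamma * mean (ph s a) f| <= gamma * d.
  rewrite -mulrBr normrM ger0_norm// ler_wpM2l//.
  by apply: mean_dist => //; exact: kernel_prob.
have d0 : 0 <= d by apply: le_trans (IHJ s).
rewrite d' ler_norml; apply/andP; split; last first.
  have := dist (pi s); have := RR s (pi s); have := vE s.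
  rewrite !ler_norml => -> /andP[_ ?] /andP[_ ?].
  have := le_bigmax 0 (fun a => Rk s a + gamma * mean (ph s a) f) (pi s); lra.
(* The default value 0 of the maximum is covered by [v >= 0]. *)
rewrite lerBrDl -lerBrDr opprK; apply: bigmax_le => [|a _].
  have /andP[? _] := vV s; have : 0 <= gamma * d by rewrite mulr_ge0.
  have : 0 <= (1 - gamma) * e by rewrite mulr_ge0//; lra.
  lra.
have := dist a; have := RR s a; have := v_ge s a.
by rewrite !ler_norml => ? /andP[? _] /andP[? _]; lra.
Qed.

End FrozenIteration.

(** * Discretized outcomes *)

Section Transfer.
Variables (d : measure_display) (Omega : measurableType d) (R : realType).
Variables (P : probability Omega R) (nS nA n : nat) (zeta : R).
Variables (p : 'I_nS -> 'I_nA -> 'I_nS -> R).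
Variables (Z : 'I_nS -> 'I_nA -> Omega -> R).
Variables (X : 'I_nS -> 'I_nA -> 'I_n -> Omega -> 'I_nS).
Hypotheses (zeta_gt0 : 0 < zeta) (pP : is_kernel p).
Hypothesis Z_unif : forall s a, uniform_rv P zeta (Z s a).
Hypothesis X_sample : forall s a i, sample_rv P (p s a) (X s a i).
Hypothesis ZX_indep : mutually_independent P Z X.

Section Cells.
Variable c : nat.
Hypothesis c_gt0 : (0 < c)%N.

(* Conditioning on the cells of all perturbations costs no union bound, since the perturbations
   are independent of the samples; the cells are open, and their endpoints are negligible. *)
Definition cell (k : nat) : set R :=
  `]k%:R * (zeta / c%:R), k.+1%:R * (zeta / c%:R)[%classic.

Lemma cell_prob s a k : (k < c)%N -> P (Z s a @^-1` cell k) = (c%:R^-1)%:E.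
Proof.
move=> kc; have [_ Zmeas] := Z_unif s a.
have c0 : 0 < c%:R :> R by rewrite ltr0n.
have h0 : 0 < zeta / c%:R by rewrite divr_gt0.
rewrite Zmeas; last exact: measurable_itv.
rewrite (_ : cell k `&` _ = cell k); last first.
  apply/setIidl => z /=; rewrite !in_itv /= => /andP[z1 z2]; apply/andP; split.
    by apply: le_lt_trans z1; rewrite mulr_ge0 ?ler0n// ltW.
  apply: (lt_le_trans z2); rewrite mulrCA ler_piMr ?(ltW zeta_gt0)//.
  by rewrite ler_pdivrMr// mul1r ler_nat.
rewrite lebesgue_measure_itv /= lte_fin ltr_pM2r// ltr_nat ltnSn -EFinB -EFinM.
by congr _%:E; rewrite -natr1; field; rewrite !gt_eqF.
Qed.

Lemma cell_disjoint k l z : cell k z -> cell l z -> k = l.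
Proof.
have h0 : 0 < zeta / c%:R by rewrite divr_gt0// ltr0n.
rewrite /cell /= !in_itv /= => /andP[k1 k2] /andP[l1 l2].
have lt1 := lt_trans k1 l2; have lt2 := lt_trans l1 k2.
by move: lt1 lt2; rewrite !ltr_pM2r// !ltr_nat !ltnS => ? ?; apply/eqP; rewrite eqn_leq; apply/andP.
Qed.

Definition outcome : finType :=
  ({ffun 'I_nS * 'I_nA -> 'I_c} * {ffun 'I_nS * 'I_nA * 'I_n -> 'I_nS})%type.

Definition outcome_event (o : outcome) : set Omega :=
  (\bigcap_(sa : 'I_nS * 'I_nA) (Z sa.1 sa.2 @^-1` cell (o.1 (sa.1, sa.2)))) `&`
  (\bigcap_(sai : 'I_nS * 'I_nA * 'I_n)
     (X sai.1.1 sai.1.2 sai.2 @^-1` [set o.2 (sai.1.1, sai.1.2, sai.2)])).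

Lemma outcome_event_measurable o : measurable (outcome_event o).
Proof.
apply: measurableI; apply: fin_bigcap_measurable => // -[].
  move=> s a _ /=; have [Zm _] := Z_unif s a.
  by rewrite -[_ @^-1` _]setTI; apply: Zm => //; exact: measurable_itv.
by move=> [s a] i _ /=; have [] := X_sample s a i (o.2 (s, a, i)).
Qed.

Lemma outcome_event_disjoint : trivIset setT outcome_event.
Proof.
move=> [m x] [m' x'] _ _ [w [[Zm Xx] [Zm' Xx']]]; congr (_, _).
  apply/ffunP => -[s a]; apply/val_inj; apply: (@cell_disjoint _ _ (Z s a w)).
    exact: (Zm (s, a)).
  exact: (Zm' (s, a)).
by apply/ffunP => -[[s a] i]; rewrite -(Xx (s, a, i))// -(Xx' (s, a, i)).
Qed.

Lemma outcome_event_prob o : P (outcome_event o) =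
  (c%:R^-1 ^+ #|{: 'I_nS * 'I_nA}| * sample_weight (fun sa => p sa.1 sa.2) o.2)%:E.
Proof.
rewrite /outcome_event (ZX_indep (B := fun s a => cell (o.1 (s, a)))
  (fun s a i => [set o.2 (s, a, i)])); last by move=> s a; exact: measurable_itv.
rewrite EFinM; congr (_ * _)%E.
  rewrite -prodr_const -prodEFin; apply: eq_bigr => sa _.
  by rewrite cell_prob.
rewrite /sample_weight -prodEFin; apply: eq_bigr => -[[s a] i] _ /=.
by have [] := X_sample s a i (o.2 (s, a, i)).
Qed.

(** A finite union of disjoint outcome events is measurable by construction, and its mass is
    computed pattern by pattern. *)
Lemma good_event (good : pred outcome) (delta : R) :
  (forall m, \sum_x sample_weight (fun sa => p sa.1 sa.2) x * (~~ good (m, x))%:R <= delta) ->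
  let E := \bigcup_(o in [set` good]) outcome_event o in
  measurable E /\ ((1 - delta)%:E <= P E)%E.
Proof.
move=> bad E; have fin : finite_set [set` good] by exact: finite_finset.
split; first by apply: fin_bigcup_measurable => // o _; exact: outcome_event_measurable.
rewrite /E measure_fin_bigcup//; last 2 first.
- exact: sub_trivIset outcome_event_disjoint.
- by move=> o _; exact: outcome_event_measurable.
rewrite -(@bigfs _ _ _ _ (index_enum outcome)) ?index_enum_uniq//; last first.
  by move=> o _; rewrite mem_index_enum.
rewrite (eq_bigr _ (fun o _ => outcome_event_prob o)) sumEFin lee_fin.
set u := c%:R^-1 ^+ _; have c0 : 0 < c%:R :> R by rewrite ltr0n.
have u0 : 0 <= u by rewrite exprn_ge0// invr_ge0.
(* The cell patterns [m] have equal masses [u] adding up to 1, so a bound holding for each pattern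
   can be averaged. *)
have -> : 1 - delta = \sum_(m : {ffun 'I_nS * 'I_nA -> 'I_c}) u * (1 - delta).
  rewrite sumr_const card_ffun card_ord -mulr_natr natrX mulrAC /u -exprMn.
  by rewrite mulVf ?gt_eqF// expr1n mul1r.
pose F m x := if good (m, x) then u * sample_weight (fun sa => p sa.1 sa.2) x else 0.
rewrite [leRHS]big_mkcond /= [leRHS](eq_bigr (fun o => F o.1 o.2)); last first.
  by case.
rewrite -(pair_bigA _ F) /=; apply: ler_sum => m _.
have -> : \sum_x F m x =
   u * (1 - \sum_x sample_weight (fun sa => p sa.1 sa.2) x * (~~ good (m, x))%:R).
  rewrite -[X in u * (X - _)](sum_sample_weight n (q := fun sa => p sa.1 sa.2)); last first.
    by move=> sa; case: pP.
  rewrite -sumrB mulr_sumr; apply: eq_bigr => x _.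
  by rewrite /F; case: (good _); rewrite /= ?mulr0 ?mulr1 ?subr0 ?subrr ?mulr0.
by rewrite ler_wpM2l// lerD2l lerN2.
Qed.

End Cells.

End Transfer.

(** * Sample size and conclusion *)

Section SampleSize.
Variables (R : realType) (nS nA : nat) (gamma zeta delta : R).
Hypotheses (nS_gt0 : (0 < nS)%N) (nA_gt0 : (0 < nA)%N).
Hypotheses (gammaP : 1 / 2 <= gamma < 1) (zetaP : 0 < zeta < 1 / 2) (deltaP : 0 < delta < 1).

Let b : R := beta nS nA gamma delta (eta_star nS nA gamma zeta delta).

Let beta_arg : R := 24 * (nS * nA)%:R * log2 (1 - gamma)^-1
  / ((1 - gamma) ^+ 2 * eta_star nS nA gamma zeta delta * delta).

(* [50] comes from the two tails times a grid of [25 / ((1 - gamma) zeta)] frozen values. *)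
Let beta_arg_ge : 50 * (nS * nA)%:R / ((1 - gamma) * zeta * delta) <= beta_arg.
Proof.
have /andP[g0 g1] := gammaP; have /andP[z0 z1] := zetaP; have /andP[d0 d1] := deltaP.
rewrite /beta_arg /eta_star; set s : R := (nS * nA)%:R; set e : R := (nS * nA ^ 2)%:R.
have s1 : 1 <= s by rewrite /s ler1n muln_gt0 nS_gt0.
have e1 : 1 <= e by rewrite /e ler1n muln_gt0 nS_gt0 expn_gt0 nA_gt0.
set g := 1 - gamma; have gP : 0 < g <= 1 / 2 by rewrite /g; apply/andP; split; lra.
have /andP[gg0 gg1] := gP.
have l1 : 1 <= log2 g^-1.
  have ln2 : 0 < ln 2 :> R by rewrite ln_gt0// ltr1n.
  rewrite /log2 ler_pdivlMr// mul1r ler_ln ?posrE ?invr_gt0//.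
  by rewrite -[2]invrK lef_pV2 ?posrE ?invr_gt0//; lra.
(* With [24 * 9 = 216], the second factor is what [beta] offers beyond the requirement; it is at
   least 1. *)
have -> : 24 * s * log2 g^-1 / (g ^+ 2 * (zeta * delta * g / (9 * e)) * delta) =
    50 * s / (g * zeta * delta) * (216 / 50 * (log2 g^-1 * e) / (g ^+ 2 * delta)).
  by field; rewrite !gt_eqF ?ltr0n.
rewrite ler_peMr//.
  by rewrite divr_ge0 ?mulr_ge0 ?ler0n// ltW.
have g2 : g ^+ 2 * delta <= 1.
  have : g ^+ 2 <= 1 by rewrite expr2; nra.
  by have := sqr_ge0 g; nra.
rewrite ler_pdivlMr ?mulr_gt0 ?exprn_gt0// mul1r (le_trans g2)//.
have : 1 <= log2 g^-1 * e by rewrite mulr_ege1.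
lra.
Qed.

Let beta_arg_gt1 : 1 < beta_arg.
Proof.
have /andP[g0 g1] := gammaP; have /andP[z0 z1] := zetaP; have /andP[d0 d1] := deltaP.
apply: lt_le_trans beta_arg_ge.
have s1 : 1 <= (nS * nA)%:R :> R by rewrite ler1n muln_gt0 nS_gt0.
rewrite ltr_pdivlMr ?mulr_gt0 ?subr_gt0// mul1r.
have : (1 - gamma) * zeta * delta <= 1 / 2 * (1 / 2) * 1.
  by apply: ler_pM; rewrite ?mulr_ge0 ?ler_pM//; lra.
lra.
Qed.

Lemma beta_gt0 : 0 < b.
Proof. by rewrite /b /beta mulr_gt0// ln_gt0// beta_arg_gt1. Qed.

(** The prefactor 2 in [beta] makes [expR (- (b / 2))] the inverse of the argument of the
    logarithm. *)
Lemma expR_half_beta : 50 * (nS * nA)%:R / ((1 - gamma) * zeta) * expR (- (b / 2)) <= delta.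
Proof.
have /andP[g0 g1] := gammaP; have /andP[z0 z1] := zetaP; have /andP[d0 d1] := deltaP.
have a0 : 0 < beta_arg by exact: lt_trans beta_arg_gt1.
have -> : expR (- (b / 2)) = beta_arg^-1.
  by rewrite /b /beta -/beta_arg mulrAC divff// mul1r expRN lnK// posrE.
rewrite ler_pdivrMr// [leRHS]mulrC -ler_pdivrMr//; apply: le_trans beta_arg_ge.
by rewrite [in leRHS]invfM mulrA.
Qed.

End SampleSize.

Lemma exprn_lt_exists (R : realType) (a e : R) : 0 <= a < 1 -> 0 < e ->
  exists J : nat, a ^+ J < e.
Proof.
move=> /andP[a0 a1] e0; have a1' : `|a| < 1 by rewrite ger0_norm.
have [J _ /(_ J (leqnn J))] := cvgr_lt _ (cvg_expr a1') _ e0.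
by exists J.
Qed.

Lemma emp_prob (R : realType) (nS n : nat) (c : 'I_n -> 'I_nS) : (0 < n)%N ->
  is_prob (emp c : 'I_nS -> R).
Proof.
move=> n0; split=> [s|]; first by rewrite divr_ge0// ler0n.
have := mean_emp c (fun=> 1 : R); rewrite /mean sumr_const card_ord divff; last first.
  by rewrite pnatr_eq0 -lt0n.
by move=> <-; apply: eq_bigr => s _; rewrite mulr1.
Qed.

(** * From the union bound to an event of the original space *)

Section HighProbabilityBound.
Variables (R : realType) (nS nA : nat).
Variables (r : 'I_nS -> 'I_nA -> R) (p : 'I_nS -> 'I_nA -> 'I_nS -> R).
Variables (gamma zeta delta : R) (n : nat).
Variables (d : measure_display) (Omega : measurableType d) (P : probability Omega R).
Variables (Z : 'I_nS -> 'I_nA -> Omega -> R).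
Variables (X : 'I_nS -> 'I_nA -> 'I_n -> Omega -> 'I_nS).
Variables (hat_v : Omega -> 'I_nS -> R) (hat_pi : Omega -> {ffun 'I_nS -> 'I_nA}).
Let b : R := beta nS nA gamma delta (eta_star nS nA gamma zeta delta).
Let t : R := tminorize p.
Let x0 : R := Num.sqrt (b * t / n%:R).

Hypotheses (nS_gt0 : (0 < nS)%N) (nA_gt0 : (0 < nA)%N).
Hypotheses (rP : forall s a, 0 <= r s a <= 1) (pP : is_kernel p).
Hypotheses (p_erg : uniformly_ergodic p) (gammaP : 1 / 2 <= gamma < 1).
Hypotheses (t_le : t <= (1 - gamma)^-1) (zetaP : 0 < zeta < 1 / 2).
Hypotheses (deltaP : 0 < delta < 1) (n_gt0 : (0 < n)%N) (x0_le : x0 <= 1 / 486).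
Hypothesis Z_unif : forall s a, uniform_rv P zeta (Z s a).
Hypothesis X_sample : forall s a i, sample_rv P (p s a) (X s a i).
Hypothesis ZX_indep : mutually_independent P Z X.
Hypothesis hat_vP : forall w, emp_bellman_fixpoint gamma (fun s a => r s a + Z s a w)
  (fun s a => emp (X s a ^~ w)) (hat_v w).
Hypothesis hat_piP : forall w, greedy gamma (fun s a => r s a + Z s a w)
  (fun s a => emp (X s a ^~ w)) (hat_v w) (hat_pi w).

(** Enough cells for a width [h <= (1 - gamma) * zeta / 16], the reward error allowed by
    [frozen_iter_dist] at [e = zeta / 16]. *)
Let c : nat := (Num.truncn (16 / (1 - gamma))).+1.
Let h : R := zeta / c%:R.
(** A grid of step [zeta / 16] covering the range [3 / 2 / (1 - gamma)] of [hat_v]. *)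
Let N : nat := (Num.truncn (24 / ((1 - gamma) * zeta))).+1.

(** Rewards are rounded down to the left endpoints of their cells, so that only [m] and the samples
    enter. *)
Let W (J : nat) (m : {ffun 'I_nS * 'I_nA -> 'I_c}) (k : 'I_nS * 'I_nA) (j : 'I_N)
  (x : {ffun 'I_nS * 'I_nA * 'I_n -> 'I_nS}) : 'I_nS -> R :=
  frozen_iter gamma (fun s a => r s a + (m (s, a))%:R * h)
    (fun s a => emp (row (s, a) x)) k.1 (j%:R * (zeta / 16)) J.

(** Freezing the state [k.1] hides the samples of all its actions, those of row [k] among them. *)
Let W_row J m k j x y : W J m k j (set_row k x y) = W J m k j x.
Proof.
apply: frozen_iter_ext => s a sk; congr emp; congr fun_of_fin.
apply/ffunP => i; rewrite !ffunE /=; case: eqP => // sak.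
by rewrite -sak eqxx in sk.
Qed.

Let good J (o : outcome nS nA n c) : bool :=
  ~~ [exists kj : ('I_nS * 'I_nA) * 'I_N,
    deviates (fun sa => p sa.1 sa.2) t x0 kj.1 (W J o.1 kj.1 kj.2 o.2) (row kj.1 o.2)].

Let t_gt0 : 0 < t.
Proof.
by apply: (lt_le_trans ltr01); exact: (tminorize_ge1 p_erg [ffun=> Ordinal nA_gt0]).
Qed.

Let b_gt0 : 0 < b. Proof. exact: beta_gt0. Qed.

Let x0_gt0 : 0 < x0.
Proof.
rewrite sqrtr_gt0; apply: divr_gt0; last by rewrite ltr0n.
exact: mulr_gt0 b_gt0 t_gt0.
Qed.

Let bad_le J m : \sum_x sample_weight (fun sa => p sa.1 sa.2) x *
  (~~ good J (m, x))%:R <= delta.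
Proof.
have /andP[g0 g1] := gammaP; have /andP[z0 z1] := zetaP; have /andP[d0 d1] := deltaP.
have qP (k : 'I_nS * 'I_nA) : is_prob (p k.1 k.2) by exact: kernel_prob.
have x0P : 0 < x0 <= 1 / 2 by rewrite x0_gt0 (le_trans x0_le)//; lra.
under eq_bigr => x _ do rewrite negbK.
apply: (le_trans (union_bound qP n_gt0 t_gt0 x0P (W_row J m))).
have -> : n%:R * x0 ^+ 2 / (2 * t) = b / 2.
  rewrite /x0 sqr_sqrtr; last first.
    by apply: divr_ge0; [exact/ltW/(mulr_gt0 b_gt0 t_gt0) | exact: ler0n].
  by field; rewrite (gt_eqF t_gt0) pnatr_eq0 -lt0n n_gt0.
rewrite card_prod !card_ord.
apply: le_trans (expR_half_beta nS_gt0 nA_gt0 gammaP zetaP deltaP).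
rewrite mulrA ler_wpM2r ?expR_ge0// natrM.
have g : 0 < (1 - gamma) * zeta by rewrite mulr_gt0// subr_gt0.
have N_le : N%:R <= 25 / ((1 - gamma) * zeta).
  have /truncn_itv/andP[Nle _] : 0 <= 24 / ((1 - gamma) * zeta) by rewrite divr_ge0// ltW.
  rewrite /N -natr1; have : 1 <= 1 / ((1 - gamma) * zeta).
    by rewrite ler_pdivlMr// mul1r; nra.
  lra.
have : (nS * nA)%:R * N%:R <= (nS * nA)%:R * (25 / ((1 - gamma) * zeta)) by rewrite ler_wpM2l.
lra.
Qed.

(** On an outcome event the samples equal the table [x] and the perturbations are known up to [h],
    so the deterministic bound applies with frozen iterates as surrogates. *)
Let good_gap J w o : gamma ^+ J < zeta * (1 - gamma) / 24 -> good J o ->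
  outcome_event zeta Z X o w -> forall s,
  vstar gamma r p s - vpi gamma r p (hat_pi w) s <=
    2 * zeta / (1 - gamma) + 486 * x0 / (1 - gamma).
Proof.
case: o => m x J_le goodo [Zm Xx].
have /andP[g0 g1] := gammaP; have /andP[z0 z1] := zetaP.
have g01 : 0 <= gamma < 1 by apply/andP; split; lra.
have c_gt0 : 0 < c%:R :> R by rewrite ltr0n.
have h0 : 0 < h by rewrite divr_gt0.
have h_le : h <= (1 - gamma) * (zeta / 16).
  have /truncn_itv/andP[_ clt] : 0 <= 16 / (1 - gamma) by rewrite divr_ge0//; lra.
  rewrite /h ler_pdivrMr//; move: clt; rewrite -/c ltr_pdivrMr; last lra.
  move=> cg; have : zeta * 16 <= zeta * (c%:R * (1 - gamma)) by rewrite ler_wpM2l// ltW.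
  lra.
have cellP s a : (m (s, a))%:R * h < Z s a w < ((m (s, a)).+1)%:R * h.
  by have := Zm (s, a) I; rewrite /cell /= in_itv.
have XE s a : X s a ^~ w = row (s, a) x.
  by apply/funext => i; rewrite ffunE (Xx (s, a, i)).
pose Rw s a := r s a + Z s a w; pose ph s a : 'I_nS -> R := emp (X s a ^~ w).
have phP : is_kernel ph.
  by split=> [s a s'|s a]; have [e0 e1] := emp_prob R (X s a ^~ w) n_gt0; [exact: e0 | exact: e1].
have RwP s a : r s a <= Rw s a <= r s a + zeta.
  have /andP[z1' z2'] := cellP s a; rewrite /Rw lerDl lerD2l; apply/andP; split.
    by apply: ltW; apply: le_lt_trans z1'; rewrite mulr_ge0// ltW.
  apply: (le_trans (ltW z2')); rewrite /h mulrCA ler_piMr ?(ltW z0)//.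
  by rewrite ler_pdivrMr// mul1r ler_nat.
have v_ge s a : Rw s a + gamma * mean (ph s a) (hat_v w) <= hat_v w s.
  rewrite [leRHS]hat_vP.
  exact: (le_sup_fin (fun a => Rw s a + gamma * mean (ph s a) (hat_v w))).
have vE s : hat_v w s =
    Rw s (hat_pi w s) + gamma * mean (ph s (hat_pi w s)) (hat_v w).
  rewrite [LHS]hat_vP.
  by apply: (sup_fin_max (f := fun a => Rw s a + gamma * mean (ph s a) (hat_v w))) => a;
    exact: hat_piP.
have v0 s : 0 <= hat_v w s.
  by exact: (greedy_value_ge0 (r := r) (zeta := zeta) gammaP rP RwP phP vE).
have v1 s : hat_v w s <= 3 / 2 / (1 - gamma).
  exact: (greedy_value_le (r := r) (zeta := zeta) gammaP rP zetaP RwP phP vE).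
apply: (greedy_policy_gap (zeta := zeta) (Rw := Rw) (ph := ph) (v := hat_v w)) => //.
- by rewrite x0_le ltW.
- move=> s a.
  have vz0 : 0 <= hat_v w s * (16 / zeta) by rewrite mulr_ge0// divr_ge0// ltW.
  (* The index of the grid point just below the value at [s]. *)
  have jN : (Num.truncn (hat_v w s * (16 / zeta)) < N)%N.
    rewrite ltnS le_truncn//.
    have -> : 24 / ((1 - gamma) * zeta) = 3 / 2 / (1 - gamma) * (16 / zeta).
      by field; rewrite !gt_eqF// subr_gt0.
    by rewrite ler_wpM2r// divr_ge0// ltW.
  pose j := Ordinal jN.
  exists (W J m (s, a) j x); split.
    (* Half of [zeta / 8] pays for the rounding of value and rewards, half for stopping after [J]
       iterations. *)
    move=> i; apply: (@le_trans _ _ (zeta / 16 + gamma ^+ J * (3 / 2 / (1 - gamma)))); last first.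
      have : gamma ^+ J * (3 / 2 / (1 - gamma)) <= zeta / 16.
        rewrite mulrA ler_pdivrMr; last lra.
        lra.
      lra.
    have -> : W J m (s, a) j x = frozen_iter gamma
        (fun s a => r s a + (m (s, a))%:R * h) ph s (j%:R * (zeta / 16)) J.
      rewrite /W; congr frozen_iter; apply/funext => s'; apply/funext => a'.
      by rewrite /ph XE.
    apply: (@frozen_iter_dist _ _ _ gamma Rw _ ph s _ J (hat_v w) (hat_pi w)) => //.
    + by move=> s'; rewrite v0 v1.
    + lra.
    + have /truncn_itv/andP[j1 j2] := vz0.
      have zz : 0 < zeta / 16 by lra.
      have e : hat_v w s * (16 / zeta) * (zeta / 16) = hat_v w s.
        by field; rewrite gt_eqF.
      have := ler_wpM2r (ltW zz) j1; have := ler_wpM2r (ltW zz) (ltW j2).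
      rewrite e -natr1 => k1 k2; rewrite ler_norml; apply/andP; split; rewrite /=; lra.
    + move=> s' a'; have /andP[k1 k2] := cellP s' a'; rewrite /Rw; move: k2; rewrite -natr1.
      by move=> k2; apply: le_trans h_le; rewrite ler_norml; apply/andP; split; lra.
  move: goodo; rewrite /good negb_exists => /forallP/(_ ((s, a), j)).
  by rewrite /deviates -leNgt /= /ph XE.
Qed.

Lemma high_probability_bound : exists E : set Omega,
  measurable E /\ ((1 - delta)%:E <= P E)%E /\
  forall w, E w -> forall s,
    vstar gamma r p s - vpi gamma r p (hat_pi w) s <=
      2 * zeta / (1 - gamma) + 486 * x0 / (1 - gamma).
Proof.
have /andP[g0 g1] := gammaP; have /andP[z0 z1] := zetaP.
have g01 : 0 <= gamma < 1 by apply/andP; split; lra.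
have e0 : 0 < zeta * (1 - gamma) / 24 by rewrite divr_gt0// mulr_gt0// subr_gt0.
have [J J_lt] := exprn_lt_exists g01 e0.
have [E_meas E_prob] := good_event z0 pP Z_unif X_sample ZX_indep (isT : (0 < c)%N) (bad_le J).
exists (\bigcup_(o in [set` good J]) outcome_event zeta Z X o); split=> //; split=> //.
by move=> w [out goodo ow]; exact: good_gap J_lt goodo ow.
Qed.

End HighProbabilityBound.

(** * The accuracy bound and the resulting choice of parameters *)

Unset Implicit Arguments.

Theorem theorem1 (R : realType) (nS nA : nat)
  (r : 'I_nS -> 'I_nA -> R) (p : 'I_nS -> 'I_nA -> 'I_nS -> R)
  (gamma zeta delta : R) (n : nat)
  (d : measure_display) (Omega : measurableType d) (P : probability Omega R)
  (Z : 'I_nS -> 'I_nA -> Omega -> R)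
  (X : 'I_nS -> 'I_nA -> 'I_n -> Omega -> 'I_nS)
  (hat_v : Omega -> 'I_nS -> R) (hat_pi : Omega -> {ffun 'I_nS -> 'I_nA}) :
  (0 < nS)%N -> (0 < nA)%N ->
  (forall s a, 0 <= r s a <= 1) ->
  is_kernel p ->
  uniformly_ergodic p ->
  1 / 2 <= gamma < 1 ->
  tminorize p <= (1 - gamma)^-1 ->
  0 < zeta -> 0 < delta < 1 ->
  (* the randomness of PMBP(gamma, zeta, n) *)
  (forall s a, uniform_rv P zeta (Z s a)) ->
  (forall s a i, sample_rv P (p s a) (X s a i)) ->
  mutually_independent P Z X ->
  (* hat_v omega = \hat v_0 and hat_pi omega = \hat\pi_0 on outcome omega *)
  (forall w, emp_bellman_fixpoint gamma (fun s a => r s a + Z s a w)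
               (fun s a => emp (X s a ^~ w)) (hat_v w)) ->
  (forall w, greedy gamma (fun s a => r s a + Z s a w)
               (fun s a => emp (X s a ^~ w)) (hat_v w) (hat_pi w)) ->
  (* main bound *)
  (64 * beta nS nA gamma delta (eta_star nS nA gamma zeta delta) / (1 - gamma)
     <= n%:R ->
   exists E : set Omega, measurable E /\ ((1 - delta)%:E <= P E)%E /\
     forall w, E w -> forall s,
       0 <= vstar gamma r p s - vpi gamma r p (hat_pi w) s <=
       2 * zeta / (1 - gamma) +
       486 * Num.sqrt (beta nS nA gamma delta (eta_star nS nA gamma zeta delta)
                        * tminorize p / ((1 - gamma) ^+ 2 * n%:R)))
  /\
  (* consequence: zeta = (1-gamma) eps / 4, n = c t beta / ((1-gamma)^2 eps^2) *)
  (forall eps : R, 0 < eps <= Num.sqrt (tminorize p / (1 - gamma)) ->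
   zeta = (1 - gamma) * eps / 4 ->
   (4 * 486 ^+ 2) * tminorize p
     * beta nS nA gamma delta (eta_star nS nA gamma zeta delta)
     / ((1 - gamma) ^+ 2 * eps ^+ 2) <= n%:R ->
   exists E : set Omega, measurable E /\ ((1 - delta)%:E <= P E)%E /\
     forall w, E w -> forall s,
       `| vstar gamma r p s - vpi gamma r p (hat_pi w) s | <= eps).
Proof.
move=> nS_gt0 nA_gt0 rP pP p_erg gammaP t_le z0 deltaP Z_unif X_sample ZX_indep hat_vP hat_piP.
have /andP[g0 g1] := gammaP; have g01 : 0 <= gamma < 1 by apply/andP; split; lra.
set b := beta nS nA gamma delta _; set t := tminorize p in t_le *.
have H0 : 0 < (1 - gamma)^-1 by rewrite invr_gt0 subr_gt0.
have n0R : 0 <= n%:R :> R by exact: ler0n.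
have t0 : 0 < t.
  by apply: (lt_le_trans ltr01); exact: (tminorize_ge1 p_erg [ffun=> Ordinal nA_gt0]).
have sqrtE : Num.sqrt (b * t / ((1 - gamma) ^+ 2 * n%:R)) =
    Num.sqrt (b * t / n%:R) * (1 - gamma)^-1.
  have -> : b * t / ((1 - gamma) ^+ 2 * n%:R) = (1 - gamma)^-1 ^+ 2 * (b * t / n%:R).
    by rewrite invfM exprVn mulrCA.
  by rewrite sqrtrM ?sqr_ge0// sqrtr_sqr gtr0_norm// mulrC.
have main : 64 * b / (1 - gamma) <= n%:R ->
  exists E : set Omega, measurable E /\ ((1 - delta)%:E <= P E)%E /\
    forall w, E w -> forall s,
      0 <= vstar gamma r p s - vpi gamma r p (hat_pi w) s <=
      2 * zeta / (1 - gamma) +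
      486 * Num.sqrt (b * t / ((1 - gamma) ^+ 2 * n%:R)).
  move=> n_ge; rewrite sqrtE; set x0 := Num.sqrt _; set H := (1 - gamma)^-1 in H0 t_le n_ge *.
  have x00 : 0 <= x0 by exact: sqrtr_ge0.
  have gap_ge0 w s : 0 <= vstar gamma r p s - vpi gamma r p (hat_pi w) s.
    by rewrite subr_ge0 vpi_le_vstar.
  have xH : 0 <= x0 * H by rewrite mulr_ge0// ltW.
  have zH : 0 <= zeta * H by rewrite mulr_ge0// ltW.
  (* Every gap is at most [H], so the whole space serves as the event. *)
  have trivial_case : H <= 2 * (zeta * H) + 486 * (x0 * H) ->
      exists E : set Omega, measurable E /\ ((1 - delta)%:E <= P E)%E /\
        forall w, E w -> forall s,
          0 <= vstar gamma r p s - vpi gamma r p (hat_pi w) s <=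
          2 * zeta * H + 486 * (x0 * H).
    move=> H_le; exists setT; split=> //; split.
      by rewrite probability_setT lee_fin; have /andP[? ?] := deltaP; lra.
    move=> w _ s; rewrite gap_ge0 /=.
    by have := vstar_gap_trivial (hat_pi w) pP g01 s rP; rewrite div1r -/H; lra.
  have [z_ge|z_lt] := leP (1 / 2) zeta.
    apply: trivial_case; have : 1 / 2 * H <= zeta * H by rewrite ler_wpM2r// ltW.
    lra.
  have [x_ge|x_lt] := leP (1 / 486) x0.
    apply: trivial_case; have : 1 / 486 * H <= x0 * H by rewrite ler_wpM2r// ltW.
    lra.
  have zetaP : 0 < zeta < 1 / 2 by rewrite z0 z_lt.
  have b0 : 0 < b := beta_gt0 nS_gt0 nA_gt0 gammaP zetaP deltaP.
  have n_gt0 : (0 < n)%N.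
    rewrite -(ltr0n R); apply: (lt_le_trans _ n_ge); apply: mulr_gt0 => //.
    lra.
  have [E [E_meas [E_prob E_gap]]] := high_probability_bound nS_gt0 nA_gt0 rP pP p_erg gammaP t_le
    zetaP deltaP n_gt0 (ltW x_lt) Z_unif X_sample ZX_indep hat_vP hat_piP.
  exists E; split=> //; split=> // w Ew s; rewrite gap_ge0 /=.
  by have := E_gap w Ew s; rewrite -/b -/t -/x0 -/H; lra.
split; first exact: main.
move=> eps /andP[eps0 eps_le] zetaE; set c : R := 4 * 486 ^+ 2 => n_ge.
have g1' : 0 < 1 - gamma by rewrite subr_gt0.
have tH0 : 0 <= t / (1 - gamma) by rewrite divr_ge0// ltW.
have eps2 : eps ^+ 2 <= t / (1 - gamma).
  by rewrite -[leRHS]sqr_sqrtr// lerXn2r ?nnegrE ?sqrtr_ge0// ltW.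
(* From [eps^2 <= t H <= H^2]; it forces [zeta <= 1 / 4]. *)
have eps_H : eps <= (1 - gamma)^-1.
  rewrite -ler_sqr ?nnegrE ?(ltW eps0) ?(ltW H0)//; apply: (le_trans eps2).
  by rewrite expr2 ler_wpM2r// ltW.
have zetaP : 0 < zeta < 1 / 2.
  rewrite z0 zetaE; have : (1 - gamma) * eps <= (1 - gamma) * (1 - gamma)^-1.
    by rewrite ler_wpM2l// ltW.
  by rewrite divff ?gt_eqF//; lra.
have b0 : 0 < b := beta_gt0 nS_gt0 nA_gt0 gammaP zetaP deltaP.
have eps20 : 0 < eps ^+ 2 by rewrite exprn_gt0.
have c0 : 64 <= c by rewrite /c; lra.
have n_ge' : 64 * b / (1 - gamma) <= n%:R.
  apply: le_trans n_ge; rewrite ler_pdivlMr ?mulr_gt0 ?exprn_gt0//.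
  have -> : 64 * b / (1 - gamma) * ((1 - gamma) ^+ 2 * eps ^+ 2) =
      64 * b * ((1 - gamma) * eps ^+ 2) by field; rewrite gt_eqF.
  have e : (1 - gamma) * eps ^+ 2 <= t by rewrite mulrC -ler_pdivlMr.
  have ct : 64 * ((1 - gamma) * eps ^+ 2) <= c * t by apply: ler_pM => //; rewrite mulr_ge0// ltW.
  by have := ler_wpM2r (ltW b0) ct; lra.
have [E [E_meas [E_prob E_gap]]] := main n_ge'.
exists E; split=> //; split=> // w Ew s; have /andP[gap0 gap1] := E_gap w Ew s.
rewrite ger0_norm//; apply: (le_trans gap1).
have n0 : 0 < n%:R :> R.
  by apply: (lt_le_trans _ n_ge'); apply: mulr_gt0; [lra | rewrite invr_gt0].
(* The budget [eps] is split evenly between perturbation and sampling; [c = 4 * 486 ^+ 2] is the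
   square of [2 * 486]. *)
have -> : 2 * zeta / (1 - gamma) = eps / 2 by rewrite zetaE; field; rewrite gt_eqF.
suff : Num.sqrt (b * t / ((1 - gamma) ^+ 2 * n%:R)) <= eps / (2 * 486) by lra.
have e0 : 0 <= eps / (2 * 486) by lra.
rewrite -[leRHS]ger0_norm// -sqrtr_sqr ler_wsqrtr//.
rewrite ler_pdivrMr ?mulr_gt0 ?exprn_gt0//.
move: n_ge; rewrite ler_pdivrMr ?mulr_gt0 ?exprn_gt0// /c => n_ge.
rewrite expr_div_n; lra.
Qed.
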